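(* Let $k\geq 1$. For any self-conjugate Young diagram $\lambda$ and any pattern (permutation) $\tau$, the set-valued statistic $\mathrm{Peak}$ is equidistributed over $\mathcal{ST}_{\lambda}(I_k\oplus\tau)$ and $\mathcal{ST}_{\lambda}(J_k\oplus\tau)$, that is, $$\sum_{T \in \mathcal{ST}_{\lambda}(I_k\oplus\tau)}t^{\mathrm{Peak}(T)} = \sum_{T \in \mathcal{ST}_{\lambda}(J_k\oplus\tau)}t^{\mathrm{Peak}(T)}.$$
   Context: Young diagrams are identified with integer partitions and drawn left-justified; the square $(i,j)$ is the square in the $i$-th column (columns numbered left to right) and $j$-th row (rows numbered top to bottom). $c_j(\lambda)$ denotes the length of the $j$-th column of $\lambda$. $\lambda$ is self-conjugate if it equals its reflection $\lambda^T$ along the main diagonal. A transversal $T$ of shape $\lambda$ is a $01$-filling of the squares of $\lambda$ such that each row and each column contains exactly one $1$. If $\lambda$ has $n$ columns, write $T=t_1t_2\cdots t_n$, where the $1$ in column $i$ is in the square $(i,t_i)$. A transversal of a self-conjugate Young diagram $\lambda$ is symmetric if the square $(i,j)$ contains a $1$ if and only if the square $(j,i)$ contains a $1$. $\mathcal{ST}_\lambda$ is the set of symmetric transversals of the self-conjugate diagram $\lambda$. An index $i$ with $2\le i\le n-1$ and $c_{i-1}(\lambda)=c_i(\lambda)=c_{i+1}(\lambda)$ is a peak of $T$ if $t_{i-1}<t_i>t_{i+1}$. $\mathrm{Peak}(T)$ is the set of peaks of $T$. $T$ contains a pattern $\sigma\in\mathcal{S}_m$ (a permutation of $\{1,\dots,m\}$)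 if there are rows $r_1<\cdots<r_m$ and columns $c_1<\cdots<c_m$ such that every square $(c_i,r_j)$ lies in $\lambda$ and the restriction of $T$ to these rows and columns is the permutation matrix of $\sigma$ (i.e. the $1$'s are exactly in squares $(c_i,r_{\sigma_i})$). Otherwise $T$ avoids $\sigma$. $\mathcal{ST}_\lambda(\sigma)$ is the set of $\sigma$-avoiding transversals in $\mathcal{ST}_\lambda$. $I_k=12\cdots k$ and $J_k=k\cdots 21$. For $\pi\in\mathcal{S}_a$ and $\sigma\in\mathcal{S}_b$, the direct sum is $\pi\oplus\sigma=\pi_1\cdots\pi_a(\sigma_1+a)\cdots(\sigma_b+a)$; for the empty permutation $\epsilon$, $\pi\oplus\epsilon=\pi$. For a finite set $A$ of positive integers, $t^A=\prod_{i\in A}t_i$ with $t_1,t_2,\ldots$ commuting indeterminates, and $t^{\emptyset}=1$. *)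

(* Defs.v *)
From HB Require Import structures.
From mathcomp Require Import all_boot all_order all_algebra all_fingroup.
From mathcomp Require Export mpoly.

Set Implicit Arguments.
Unset Strict Implicit.
Unset Printing Implicit Defensive.

Import GRing.Theory.

(* All indices are 0-based: the square (i, j) of the code, in column i and row
   j, is the square (i+1, j+1) in the usual 1-based convention. *)

(* A Young diagram is given by its row lengths, from top to bottom. *)
Definition is_partition (la : seq nat) : bool := sorted geq la && (0 \notin la).

Definition in_shape (la : seq nat) (i j : nat) : bool := i < nth 0 la j.

Definition ncols (la : seq nat) : nat := head 0 la.
Definition nrows (la : seq nat) : nat := size la.

Definition col_len (la : seq nat) (i : nat) : nat := count (ltn i) la.

Definition conj_part (la : seq nat) : seq nat := mkseq (col_len la) (ncols la).

Definition self_conjugate (la : seq nat) : bool := conj_part la == la.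

(* A 01-filling is the set of squares containing a 1; it may a priori use any
   square of the bounding rectangle of la, [transversal] keeps it inside la. *)
Definition filling (la : seq nat) : finType :=
  {set 'I_(ncols la) * 'I_(nrows la)}.

Definition transversal (la : seq nat) (T : filling la) : bool :=
  [&& [forall p in T, in_shape la p.1 p.2],
      [forall i : 'I_(ncols la), #|[set j | (i, j) \in T]| == 1] &
      [forall j : 'I_(nrows la), #|[set i | (i, j) \in T]| == 1]].

(* Row and column indices live in different types, so a square and its
   reflection are compared through the values of their coordinates. *)
Definition symmetric_filling (la : seq nat) (T : filling la) : bool :=
  [forall p : 'I_(ncols la) * 'I_(nrows la),
   forall q : 'I_(ncols la) * 'I_(nrows la),
     (p.1 == q.2 :> nat) && (p.2 == q.1 :> nat) ==>
       ((p \in T) == (q \in T))].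

Definition ST (la : seq nat) : {set filling la} :=
  [set T : filling la | transversal T && symmetric_filling T].

(* The row t_i of the 1 in column i; the value 0 for a column without a 1 is
   irrelevant for transversals. *)
Definition word (la : seq nat) (T : filling la) (i : 'I_(ncols la)) : nat :=
  if [pick j | (i, j) \in T] is Some j then nat_of_ord j else 0.

Definition Peak (la : seq nat) (T : filling la) : {set 'I_(ncols la)} :=
  [set i : 'I_(ncols la) |
    [exists h : 'I_(ncols la), exists j : 'I_(ncols la),
      [&& i == h.+1 :> nat, j == i.+1 :> nat,
          col_len la h == col_len la i, col_len la i == col_len la j,
          word T h < word T i & word T j < word T i]]].

Definition contains (la : seq nat) (T : filling la) (m : nat) (s : 'S_m)
    : bool :=
  [exists c : {ffun 'I_m -> 'I_(ncols la)},
   exists r : {ffun 'I_m -> 'I_(nrows la)},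
    [&& [forall x : 'I_m, forall y : 'I_m, (x < y) ==> (c x < c y)],
        [forall x : 'I_m, forall y : 'I_m, (x < y) ==> (r x < r y)],
        [forall x : 'I_m, forall y : 'I_m, in_shape la (c x) (r y)] &
        [forall x : 'I_m, forall y : 'I_m,
           ((c x, r y) \in T) == (y == s x)]]].

Definition ST_avoid (la : seq nat) (m : nat) (s : 'S_m) : {set filling la} :=
  [set T in ST la | ~~ contains T s].

Definition incr_perm (k : nat) : 'S_k := 1%g.
Definition decr_perm (k : nat) : 'S_k := perm (@rev_ord_inj k).

Definition dsum_fun (a b : nat) (p : 'S_a) (s : 'S_b) (i : 'I_(a + b))
    : 'I_(a + b) :=
  match split i with
  | inl x => lshift b (p x)
  | inr y => rshift a (s y)
  end.

Lemma dsum_fun_inj (a b : nat) (p : 'S_a) (s : 'S_b) :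
  injective (dsum_fun p s).
Proof.
move=> i j; rewrite /dsum_fun -{2}[i]splitK -{2}[j]splitK.
case: (split i) => x; case: (split j) => y /=.
- by move/lshift_inj/perm_inj => ->.
- by move/eqP; rewrite eq_lrshift.
- by move/eqP; rewrite eq_rlshift.
- by move/rshift_inj/perm_inj => ->.
Qed.

Definition dsum (a b : nat) (p : 'S_a) (s : 'S_b) : 'S_(a + b) :=
  perm (@dsum_fun_inj a b p s).

(* The monomial t^A; every peak of a transversal of la is a column of la, so
   one indeterminate per column is enough: 'X_i stands for t_(i+1). *)
Definition tmonomial (n : nat) (A : {set 'I_n}) : {mpoly int[n]} :=
  (\prod_(i in A) 'X_i)%R.

Definition Peak_gf (la : seq nat) (S : {set filling la})
    : {mpoly int[ncols la]} :=
  (\sum_(T in S) tmonomial (Peak T))%R.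

(* Main.v *)
Require Import Defs.
From mathcomp Require Import all_boot all_order all_algebra all_fingroup zify.

Set Implicit Arguments.
Unset Strict Implicit.
Unset Printing Implicit Defensive.

(** A symmetric transversal is read through the growth diagram that the
    Robinson-Schensted correspondence attaches to its 1s: each corner of the grid
    gets a partition, and two neighbouring corners have equal partitions or
    partitions that differ by one cell.  An edge is labelled by the row of that
    cell, or by [None], and a square with its 1 or without determines its lower
    and right labels from its upper and left ones by the local rule [step].  The
    labels at the boundary of the shape form a word, with one letter for each
    index because a symmetric filling has a symmetric diagram.  Words of fillings
    are exactly those whose letters describe a walk through partitions along the
    boundary ([word_valid], [word_surj]), and the word determines the filling
    ([word_inj]), since the local rule can be run backwards.

    Three things can be read off the word.  The longest increasing chain in a
    rectangle of the shape is the first row of the partition at its corner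
    ([inc_occP]); the longest decreasing chain is the number of its rows
    ([dec_occP]); and the descents between columns of equal height are the rises
    of the word ([word_desc]).  So transposing all the partitions on the boundary
    is a bijection from the transversals that avoid I_k and have peak set P to
    those that avoid J_k and have valley set P ([transpose_card]).

    What remains is that on the transversals that avoid J_k the set of peaks and
    the set of valleys have the same distribution ([peak_valley]).  Avoiding J_k
    just bounds the letters of the word, so letters may be rearranged inside a
    block of neighbouring columns of equal height as long as the walk stays among
    the partitions.  Cut the columns into such blocks, in an arbitrary way.  A
    block without inner peak is a word that increases strictly and then decreases
    weakly: it adds a vertical strip and then a horizontal one; a block without
    inner valley does it in the opposite order.  Given the content of the block,
    either word is determined by the set of rows met in its strictly increasing
    part, apart from the largest, respectively the smallest, row; passing to the
    next larger row matches these sets and preserves validity ([exch],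
    [exch_pvalid]).  Hence, for each choice of the blocks, as many transversals
    have no inner peak as have no inner valley ([hybrid0n]), and these equalities
    form a triangular system for the numbers of transversals with given peak set
    ([triangular]).

    A pattern [tau] to the lower right reduces to this case.  A transversal avoids
    I_k (+) tau, or J_k (+) tau, when it has no I_k, or J_k, whose corner lies in
    the region of the squares that have [tau] to their lower right, or whose
    reflection has ([contains_incr], [contains_decr]); the region depends only on the 1s outside
    of it ([class_region]), and these also determine all that the peak set needs
    to know besides the peaks inside the region ([Peak_key]).  Keeping the 1s
    outside and applying the first part inside gives the theorem. *)

(** * Growth diagrams of symmetric fillings *)

(** The local rule: [a] enters a square from above, [b] from the left, and the
    result leaves below.  When both carry the same row, the next row takes the
    new cell.  Outside of the shape labels cross unchanged, so that the labels of
    the boundary are met again at the border of a large enough square grid. *)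
Definition step (inR eps : bool) (a b : option nat) : option nat :=
  if inR then if eps then Some 0 else if a == b then omap succn a else a
  else a.

Lemma sorted_last x s : sorted ltn s -> x \in s -> x <= last 0 s.
Proof.
case/lastP: s => // s z; rewrite (sorted_pairwise ltn_trans) pairwise_rcons.
case/andP=> /allP a _; rewrite last_rcons mem_rcons inE.
by case/predU1P => [->//|/a/ltnW].
Qed.

Lemma sorted_gtn_head (f : nat -> nat) x s :
  sorted gtn (map f s) -> x \in s -> f x <= f (head 0 s).
Proof.
have gt_trans : transitive gtn by move=> ? ? ?; rewrite /gtn /=; lia.
case: s => // y s /=; rewrite (path_sortedE gt_trans) => /andP[/allP a _].
by rewrite inE => /predU1P[->//|xs]; apply/ltnW/a/map_f.
Qed.

Section Growth.
Variables (h t : nat -> nat).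
Hypothesis hsym : forall i j, (j < h i) = (i < h j).
Hypothesis tK : involutive t.

(* [h] gives the column lengths of a self-conjugate shape: [y < h x] says that
   the square in column [x] and row [y] belongs to it. *)

Definition dot (x y : nat) := (y < h x) && (t x == y).

(** [edge x y] is the label of the upper edge of the square [(x, y)].  By symmetry
    the left edge of that square carries [edge y x], so the horizontal labels
    suffice; [m] is the recursion depth [x + y]. *)
Fixpoint grow (m x y : nat) : option nat :=
  match m, y with
  | m'.+1, y'.+1 =>
      step (y' < h x) (dot x y') (grow m' x y') (grow m' y' x)
  | _, _ => None
  end.

Definition edge (x y : nat) : option nat := grow (x + y) x y.

Lemma edge0 x : edge x 0 = None.
Proof. by rewrite /edge; case: (x + 0). Qed.

Lemma edgeS x y :
  edge x y.+1 = step (y < h x) (dot x y) (edge x y) (edge y x).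
Proof. by rewrite /edge addnS /= [y + x]addnC. Qed.

Lemma dotC x y : dot x y = dot y x.
Proof. by rewrite /dot hsym (can2_eq tK tK) eq_sym. Qed.

Lemma shape_anti i j : i <= j -> h j <= h i.
Proof.
move=> ij; case: (posnP (h j)) => [->//|hj].
have : (h j).-1 < h j by rewrite prednK.
by rewrite hsym => /(leq_ltn_trans ij); rewrite -hsym prednK.
Qed.

Lemma edge_None x y : (edge x y == None) = ~~ ((t x < y) && (t x < h x)).
Proof.
elim: y => [|y IH]; first by rewrite edge0.
rewrite edgeS /step /dot.
case: (ltnP y (h x)) => yh /=; last by rewrite IH; lia.
case: (eqVneq (t x) y) => [->|nty]; first by rewrite ltnS leqnn yh.
rewrite [_ < y.+1]ltnS leq_eqVlt (negPf nty) /= -IH.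
by case: ifP => // _; case: (edge x y).
Qed.

Lemma dot_edge x y : dot x y -> edge x y = None.
Proof.
by move=> /andP[_ /eqP txy]; apply/eqP; rewrite edge_None txy ltnn.
Qed.

Lemma edge_dot x y : dot x y -> edge x y.+1 = Some 0.
Proof. by move=> d; rewrite edgeS d; case/andP: d => ->. Qed.

Lemma edge_out x y : h x <= y -> edge x y.+1 = edge x y.
Proof. by move=> d; rewrite edgeS /step ltnNge d. Qed.

Lemma edge_neq x y : edge x y != edge y x -> edge x y.+1 = edge x y.
Proof.
rewrite edgeS /step; case: (boolP (dot x y)) => [d|_].
  by rewrite (dot_edge d) (dot_edge (etrans (dotC y x) d)).
by move=> /negPf->; case: ifP.
Qed.

Lemma edge_eq x y : y < h x -> ~~ dot x y -> edge x y = edge y x ->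
  edge x y.+1 = omap succn (edge x y).
Proof. by rewrite edgeS /step => -> /negPf-> ->; rewrite eqxx. Qed.

Lemma edge_out_le x y y' : h x <= y -> y <= y' -> edge x y' = edge x y.
Proof.
move=> hy; elim: y' => [|y' IH]; first by rewrite leqn0 => /eqP->.
by rewrite leq_eqVlt => /predU1P[->//|yy']; rewrite edge_out ?IH //; lia.
Qed.

(** These are the squares where Viennot's shadow lines of rank [r] turn: level 0
    consists of the 1s, and each level is the set of shadow points of the one
    before. *)
Definition level (r x y : nat) :=
  [&& y < h x, edge x y.+1 == Some r & edge y x.+1 == Some r].

Lemma levelC r x y : level r x y = level r y x.
Proof. by rewrite /level hsym [X in _ && X]andbC. Qed.

(** The upper, left, lower and right labels of a square of the shape. *)
Variant cross_spec (x y : nat) :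
  option nat -> option nat -> option nat -> option nat -> bool -> Type :=
 | CrossDot of dot x y : cross_spec x y None None (Some 0) (Some 0) true
 | CrossNone of ~~ dot x y : cross_spec x y None None None None false
 | CrossEq r of ~~ dot x y : cross_spec x y (Some r) (Some r) (Some r.+1) (Some r.+1) false
 | CrossNeq a b of a != b & ~~ dot x y : cross_spec x y a b a b false.

Lemma crossP x y : y < h x ->
  cross_spec x y (edge x y) (edge y x) (edge x y.+1) (edge y x.+1) (dot x y).
Proof.
move=> yh; have xh : x < h y by rewrite -hsym.
case: (boolP (dot x y)) => [d|nd].
  have d' : dot y x by rewrite dotC.
  by rewrite !edge_dot // !dot_edge //; constructor.
have nd' : ~~ dot y x by rewrite dotC.
case: (eqVneq (edge x y) (edge y x)) => [e|ne].
  rewrite !edge_eq // -e; case: (edge x y) => [r|] /=; by constructor.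
by rewrite !edge_neq // 1?eq_sym //; constructor.
Qed.

Lemma level0 x y : level 0 x y = dot x y.
Proof.
rewrite /level; case: (ltnP y (h x)) => [yh|yh] /=; last first.
  by rewrite /dot ltnNge yh.
case: (crossP yh) => //= [a b ab _].
by apply/negbTE; apply: contra ab => /andP[/eqP-> /eqP->].
Qed.

Lemma level_in x y r : level r x y -> y < h x.
Proof. by case/and3P. Qed.

Lemma level_bot x y r : level r x y -> edge x y.+1 = Some r.
Proof. by case/and3P => _ /eqP. Qed.

Lemma level_right x y r : level r x y -> edge y x.+1 = Some r.
Proof. by rewrite levelC; apply: level_bot. Qed.

Lemma levelS x y r : level r.+1 x y -> edge x y = Some r /\ edge y x = Some r.
Proof.
case/and3P => yh; case: (crossP yh) => // [r' _ /eqP[->]//|a b ab _].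
by move=> /eqP ea /eqP eb; case/eqP: ab; rewrite ea eb.
Qed.

Lemma scan_fwd r x y : y < h x -> edge x y = Some r ->
  level r.+1 x y \/ edge x y.+1 = Some r.
Proof.
move=> yh; rewrite /level yh; case: (crossP yh) => //.
- by move=> r' _ [->]; left; rewrite eqxx.
- by move=> a b _ _ ->; right.
Qed.

Lemma scan_bwd r x y : y < h x -> edge x y.+1 = Some r ->
  level r x y \/ edge x y = Some r.
Proof.
move=> yh; rewrite /level yh; case: (crossP yh) => //.
- by move=> _ [<-]; left.
- by move=> r' _ [<-]; left; rewrite eqxx.
- by move=> a b _ _ ->; right.
Qed.

Lemma scan_down r x y y' : y <= y' -> y' <= h x -> edge x y = Some r ->
  (exists2 q, y <= q < y' & level r.+1 x q) \/ edge x y' = Some r.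
Proof.
move=> + + e; elim: y' => [|y' IH]; first by rewrite leqn0 => /eqP<-; right.
rewrite leq_eqVlt => /predU1P[<-|]; first by right.
rewrite ltnS => yy' yh; case: (IH yy' (ltnW yh)) => [[q q1 q2]|e'].
  by left; exists q => //; lia.
case: (scan_fwd yh e'); last by right.
by left; exists y' => //; lia.
Qed.

Lemma scan_up r x y y' : y <= y' -> y' <= h x -> edge x y' = Some r ->
  (exists2 q, y <= q < y' & level r x q) \/ edge x y = Some r.
Proof.
elim: y' => [|y' IH]; first by rewrite leqn0 => /eqP<-; right.
rewrite leq_eqVlt => /predU1P[<-|]; first by right.
rewrite ltnS => yy' yh e'; case: (scan_bwd yh e') => [l|e].
  by left; exists y' => //; lia.
case: (IH yy' (ltnW yh) e) => [[q q1 q2]|]; last by right.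
by left; exists q => //; lia.
Qed.

Lemma level_up_col r x y : level r.+1 x y -> exists2 q, q < y & level r x q.
Proof.
move=> l; have [e _] := levelS l; have yh := level_in l.
case: (scan_up (leq0n y) (ltnW yh) e) => [[q q1 q2]|]; first by exists q.
by rewrite edge0.
Qed.

Lemma shape_in x y x' y' : x <= x' -> y <= y' -> y' < h x' -> y < h x.
Proof. by move=> xx yy yh; apply: leq_trans (shape_anti xx); lia. Qed.

(** A line labelled [r] leaves the first square to the right and another leaves the
    second one downwards.  Inside the rectangle a line labelled [r] can end only at
    a square of level [r + 1]; if neither ends before, they meet at the corner
    [(x', y)], where two equal labels make such a square. *)
Lemma level_down r x y x' y' : level r x y -> level r x' y' ->
  x < x' -> y' < y -> y < h x' ->
  exists q1 q2, [/\ level r.+1 q1 q2, x < q1 <= x' & y' < q2 <= y].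
Proof.
move=> l l' xx yy yh.
have xh : x' < h y by rewrite -hsym.
case: (scan_down xx (ltnW xh) (level_right l)) => [[q q1 q2]|e].
  by exists q, y; split; rewrite ?(levelC _ q) //; lia.
case: (scan_down yy (ltnW yh) (level_bot l')) => [[q q1 q2]|e'].
  by exists x', q; split; rewrite //; lia.
exists x', y; split; [|by lia|by lia].
have nd : ~~ dot x' y by apply/negP => /dot_edge; rewrite e'.
have nd' : ~~ dot y x' by rewrite dotC.
by rewrite /level yh !edge_eq ?e ?e' ?eqxx.
Qed.

(** The same argument run backwards: lines labelled [r] enter both squares, and a
    line labelled [r] can begin only at a square of level [r]. *)
Lemma level_up r x y x' y' : level r.+1 x y -> level r.+1 x' y' ->
  x < x' -> y' < y ->
  exists q1 q2, [/\ level r q1 q2, x <= q1 < x' & y' <= q2 < y].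
Proof.
move=> l l' xx yy.
have yh := level_in l; have yh' := level_in l'.
have y'h : y' < h x by lia.
have [e _] := levelS l; have [_ e'] := levelS l'.
have xh' : x' <= h y' by rewrite ltnW // -hsym.
case: (scan_up yy (ltnW yh) e) => [[q q1 q2]|f].
  by exists x, q; split; rewrite //; lia.
case: (scan_up xx xh' e') => [[q q1 q2]|f'].
  by exists q, y'; split; rewrite ?(levelC _ q) //; lia.
by exists x, y'; split; rewrite /level ?y'h ?f ?f' ?eqxx //; lia.
Qed.

(** * Decreasing chains *)

Definition upright (p q : nat * nat) := (p.1 < q.1) && (q.2 < p.2).

Definition chain (r X Y : nat) (s : seq (nat * nat)) :=
  sorted upright s && all (fun q => [&& level r q.1 q.2, q.1 <= X & q.2 <= Y]) s.

Lemma upright_trans : transitive upright.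
Proof. by move=> q p u; rewrite /upright; lia. Qed.

(** Consecutive squares enclose squares of the next level, and the half-open
    rectangles of [level_down] keep these in decreasing position. *)
Lemma chain_down r X Y s m : Y < h X -> size s = m.+1 -> chain r X Y s ->
  exists2 u, size u = m & chain r.+1 X Y u.
Proof.
move=> YX; case: s => // p s [sz] /andP[/= ps] /andP[/and3P[lp pX pY] als].
suff [u [su cu au]] : exists u, [/\ size u = m, chain r.+1 X Y u
    & all (fun q => (p.1 < q.1) && (q.2 <= p.2)) u] by exists u.
elim: s p m sz ps lp pX pY als => [|p' s IH] p m /=.
  by move=> <- *; exists [::].
case: m => // m [sz] /andP[/andP[pp1 pp2] ps] lp pX pY.
case/andP=> /and3P[lp' pX' pY'] als.
have [u [su /andP[cu au] bu]] := IH _ _ sz ps lp' pX' pY' als.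
have ph : p.2 < h p'.1 by apply: (shape_in _ _ YX).
have [q1 [q2 [lq qx qy]]] := level_down lp lp' pp1 pp2 ph.
exists ((q1, q2) :: u); rewrite /= su; split=> //.
- rewrite /chain /= lq au (path_sortedE upright_trans) cu !andbT /=.
  apply/andP; split; last by lia.
  by apply: sub_all bu => q; rewrite /upright /=; lia.
- apply/andP; split; first by rewrite /=; lia.
  by apply: sub_all bu => q; lia.
Qed.

(** Besides the squares between consecutive ones, the row of the first square and
    the column of the last one each provide an end of the longer chain. *)
Lemma chain_up r X Y s m : size s = m.+1 -> chain r.+1 X Y s ->
  exists2 u, size u = m.+2 & chain r X Y u.
Proof.
case: s => // q s [sz] /andP[/= ps] /andP[/and3P[lq qX qY] als].
have [x0 x0q lx0] : exists2 x0, x0 < q.1 & level r x0 q.2.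
  have [x0 x0q lx0] := level_up_col (etrans (levelC _ _ _) lq).
  by exists x0; rewrite // levelC.
suff [u [su cu au]] : exists u, [/\ size u = m.+1, chain r X Y u
    & all (fun p => (q.1 <= p.1) && (p.2 < q.2)) u].
  exists ((x0, q.2) :: u); first by rewrite /= su.
  case/andP: cu => c1 c2.
  rewrite /chain /= lx0 c2 (path_sortedE upright_trans) c1 qY !andbT /=.
  apply/andP; split; last by lia.
  by apply: sub_all au => p; rewrite /upright /=; lia.
elim: s q m sz ps lq qX qY als {x0 x0q lx0} => [|q' s IH] q m /=.
  move=> <- _ lq qX qY _; have [y yq ly] := level_up_col lq.
  by exists [:: (q.1, y)]; rewrite /chain /= ly; split; lia.
case: m => // m [sz] /andP[/andP[qq1 qq2] ps] lq qX qY.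
case/andP=> /and3P[lq' qX' qY'] als.
have [u [su /andP[cu au] bu]] := IH _ _ sz ps lq' qX' qY' als.
have [p1 [p2 [lp px py]]] := level_up lq lq' qq1 qq2.
exists ((p1, p2) :: u); rewrite /= su; split=> //.
- rewrite /chain /= lp au (path_sortedE upright_trans) cu !andbT /=.
  apply/andP; split; last by lia.
  by apply: sub_all bu => p; rewrite /upright /=; lia.
- apply/andP; split; first by rewrite /=; lia.
  by apply: sub_all bu => p; lia.
Qed.

Definition bword (x : nat) : option nat := edge x (h x).

Lemma edge_word x y : h x <= y -> edge x y = bword x.
Proof. exact: edge_out_le. Qed.

Lemma edge_ge x y y' r : y <= y' -> edge x y = Some r ->
  exists2 r', edge x y' = Some r' & r <= r'.
Proof.
move=> + e; elim: y' => [|y' IH]; first by rewrite leqn0 => /eqP<-; exists r.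
rewrite leq_eqVlt => /predU1P[<-|/IH[r' e' rr']]; first by exists r.
case: (ltnP y' (h x)) => yh; last by exists r'; rewrite ?edge_out.
case: (scan_fwd yh e') => [/level_bot ->|e'']; last by exists r'.
by exists r'.+1 => //; lia.
Qed.

Lemma edge_lt x y r : edge x y = Some r -> r < y.
Proof.
elim: y x r => [|y IH] x r; first by rewrite edge0.
case: (ltnP y (h x)) => yh; last by rewrite edge_out // => /IH; lia.
case: (crossP yh) (IH x) => // [_ _ [<-]|r' _ IHr [<-]|a b _ _ IHr /IHr]//.
- by have := IHr _ erefl.
- by lia.
Qed.

(** Schensted's theorem for decreasing sequences, by Viennot's argument: passing to
    the shadow points removes a row of the partition and shortens the longest
    decreasing chain by one. *)
Lemma chain_level k X Y : Y < h X ->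
  (exists2 s, size s = k.+1 & chain 0 X Y s) <->
  (exists q, [/\ level k q.1 q.2, q.1 <= X & q.2 <= Y]).
Proof.
move=> YX; split=> [[s sz cs]|[q [lq qX qY]]].
  have [u su cu] : exists2 u, size u = 1 & chain k X Y u.
    have run m : forall r s, size s = m.+1 -> chain r X Y s ->
        exists2 u, size u = 1 & chain (r + m) X Y u.
      elim: m => [|m IH] r s' sz' cs'; first by exists s'; rewrite ?addn0.
      have [u su cu] := chain_down YX sz' cs'.
      by rewrite addnS -addSn; apply: IH cu.
    exact: run cs.
  case: u su cu => [|q []] // _ /andP[_ /=]; rewrite andbT => /and3P[*].
  by exists q.
suff run j : j <= k -> exists2 s, size s = j.+1 & chain (k - j) X Y s.
  by have := run _ (leqnn k); rewrite subnn.
elim: j => [_|j IH jk].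
  by exists [:: q]; rewrite // subn0 /chain /= lq qX qY.
have [s ss cs] := IH (ltnW jk).
have kj : k - j = (k - j.+1).+1 by lia.
rewrite kj in cs; have [u su cu] := chain_up ss cs; by exists u; rewrite ?su.
Qed.

Definition dec_occ k := exists s, [/\ size s = k, sorted ltn s,
  sorted gtn (map t s) & t (head 0 s) < h (last 0 s)].

(** A letter [r] of the word stems from a square of level [r] in its column. *)
Lemma dec_occP k : dec_occ k.+1 <-> exists x r, bword x = Some r /\ k <= r.
Proof.
split=> [[s [sz s1 s2 sh]]|[x [r [wx kr]]]].
  set X := last 0 s in sh; set Y := t (head 0 s) in sh.
  have /(chain_level _ sh)[[q1 q2] [lq /= qX qY]] :
    exists2 u, size u = k.+1 & chain 0 X Y u.
    exists [seq (x, t x) | x <- s]; first by rewrite size_map.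
    have sX x : x \in s -> x <= X by apply: sorted_last.
    have sY x : x \in s -> t x <= Y by apply: sorted_gtn_head.
    apply/andP; split.
      rewrite sorted_map; move: s2; rewrite sorted_map => s2.
      by have := sorted_relI ltn (relpre t gtn) s; rewrite s1 s2 => ->.
    rewrite all_map; apply/allP => x xs /=; rewrite level0 /dot sX ?sY // eqxx.
    by rewrite (shape_in _ _ sh) ?sX ?sY.
  have [|r e kr] := edge_ge _ (level_bot lq) (y' := h q1).
    exact: level_in lq.
  by exists q1, r.
have [[q /andP[_ qh] lq]|] := scan_up (leq0n _) (leqnn _) wx; last by rewrite edge0.
have [s sz /andP[cs /allP as_]] : exists2 s, size s = r.+1 & chain 0 x q s.
  by apply/(chain_level _ qh); exists (x, q).
have ds : s = [seq (x, t x) | x <- map fst s].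
  rewrite -map_comp -[LHS]map_id; apply/eq_in_map => -[p1 p2] /as_ /=.
  by rewrite level0 => /and3P[/andP[_ /eqP<-]].
have sc : sorted ltn (map fst s).
  by rewrite sorted_map; apply: sub_sorted cs => p p' /andP[].
have st : sorted gtn (map t (map fst s)).
  move: cs; rewrite {1}ds !sorted_map; apply: sub_sorted => p p' /=.
  by case/andP.
have bd z : z \in map fst s -> (z <= x) && (t z <= q).
  case/mapP => -[p1 p2] /as_ /=; rewrite level0 => /and3P[/andP[_ /eqP<-] zx zq].
  by move=> ->; apply/andP.
have ss : size (take k.+1 (map fst s)) = k.+1.
  by rewrite size_takel // size_map sz.
exists (take k.+1 (map fst s)); split=> //.
- exact: take_sorted.
- by rewrite map_take; apply: take_sorted.
set u := take _ _ in ss *.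
have hu : head 0 u \in map fst s.
  by apply: (@mem_take k.+1); rewrite -/u -nth0 mem_nth ?ss.
have lu : last 0 u \in map fst s.
  by apply: (@mem_take k.+1); rewrite -/u -nth_last mem_nth ?ss.
have /andP[_ b1] := bd _ hu; have /andP[b2 _] := bd _ lu.
exact: shape_in qh.
Qed.

Lemma someE (a b : nat) : (Some a == Some b) = (a == b).
Proof. by []. Qed.

Lemma noneE (a : nat) : (None == Some a) = false.
Proof. by []. Qed.

(** * Vertex partitions *)

(** At the corners of the shape this is the length of row [r] of the partition. *)
Definition vert (r x y : nat) := \sum_(i < x) (edge i y == Some r).

Lemma vertS r x y : vert r x.+1 y = vert r x y + (edge x y == Some r).
Proof. by rewrite /vert big_ord_recr. Qed.

Lemma vert0 r x : vert r x 0 = 0.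
Proof. by rewrite /vert big1 // => i _; rewrite edge0. Qed.

(** The sum along the horizontal path to [(x, y)] agrees with the sum along the
    vertical one, because the local rule conserves labels around a square. *)
Lemma vertC r x y : vert r x y = vert r y x.
Proof.
have [m] := ubnP (x + y); elim: m x y => // m IH [|x] [|y] xy.
- by [].
- by rewrite vert0 /vert big_ord0.
- by rewrite vert0 /vert big_ord0.
have e0 : vert r x y = vert r y x by apply: IH; lia.
have e1 : vert r x y.+1 = vert r y x + (edge y x == Some r).
  by rewrite IH ?vertS //; lia.
have e2 : vert r x y + (edge x y == Some r) = vert r y x.+1.
  by have := IH x.+1 y; rewrite vertS => -> //; lia.
rewrite !vertS e1 -e2 e0 {e0 e1 e2}.
case: (ltnP y (h x)) => yh; last first.
  have xh : h y <= x by rewrite leqNgt -hsym -leqNgt.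
  by rewrite !edge_out //; lia.
by case: (crossP yh) => [d|d|r' d|a b ab d]; rewrite ?someE; lia.
Qed.

(** The corner [(x, y)] lies in the closed region covered by the shape. *)
Definition closed (x y : nat) := [|| x == 0, y == 0 | y.-1 < h x.-1].

Lemma closedC x y : closed x y = closed y x.
Proof. by rewrite /closed hsym; lia. Qed.

Lemma closed_le x y x' y' : x <= x' -> y <= y' -> closed x' y' -> closed x y.
Proof.
rewrite /closed; case: x => // x; case: y => // y xx yy.
case/or3P => [||hh]; [lia|lia|apply: (shape_in _ _ hh); lia].
Qed.

(** Equal labels [r] meeting in a square add cells to the rows [r] and [r + 1], and
    the former cell already made room for the latter. *)
Lemma vert_partition x y r : closed x y -> vert r.+1 x y <= vert r x y.
Proof.
have [m] := ubnP (x + y); elim: m x y r => // m IH [|x] [|y] r xy cl.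
- by rewrite !vert0.
- by rewrite /vert big_ord0.
- by rewrite !vert0.
have yh : y < h x by rewrite /closed /= in cl.
have IH1 r' : vert r'.+1 x y <= vert r' x y.
  by apply: IH; [lia|apply: closed_le cl].
have IH2 r' : vert r'.+1 x.+1 y <= vert r' x.+1 y.
  by apply: IH; [lia|apply: closed_le cl].
have IH3 r' : vert r'.+1 x y.+1 <= vert r' x y.+1.
  by apply: IH; [lia|apply: closed_le cl].
have E r' : vert r' x y.+1 = vert r' x y + (edge y x == Some r').
  by rewrite vertC vertS vertC.
move: (IH1 r) (IH2 r) (IH3 r); rewrite !vertS !E.
case: (crossP yh) => [d|d|r' d|a b ab d].
- by rewrite !someE; lia.
- by rewrite !addn0.
- by rewrite !someE; lia.
- have : ~~ ((a == Some r.+1) && (b == Some r.+1)).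
    by apply: contra ab => /andP[/eqP-> /eqP->].
  have dis (c : option nat) : ~~ ((c == Some r) && (c == Some r.+1)).
    by case: c => // c; rewrite !someE; lia.
  move: (dis a) (dis b). lia.
Qed.

(** * Descents between columns of equal height *)

Definition le_opt (a b : option nat) :=
  match a, b with
  | Some r, Some r' => r <= r'
  | Some _, None => false
  | None, _ => true
  end.

Definition lt_opt (a b : option nat) :=
  match a, b with
  | Some r, Some r' => r < r'
  | Some _, None => false
  | None, _ => true
  end.

(* Two neighbouring columns are crossed by the same row of squares: [b] enters
   from the left, [step R d1 b a1] passes from the first to the second. *)
Lemma step_asc (R d1 d2 : bool) (a1 a2 b : option nat) :
  (d1 -> a1 = None /\ b = None) ->
  (d2 -> a2 = None /\ a1 <> None /\ step R d1 b a1 = None) ->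
  le_opt a2 a1 -> le_opt (step R d2 a2 (step R d1 b a1)) (step R d1 a1 b).
Proof.
rewrite /step; case: R => //; case: d1 => [/(_ isT)[-> _]|_].
  by case: d2 => [/(_ isT)[_ [_]]//|_]; case: a2.
case: d2 => [/(_ isT)[-> [a1N _]]|_].
  by case: a1 a1N => // a1 _; case: eqP.
rewrite [b == a1]eq_sym; case: (eqVneq a1 b) => [<-|ab] le.
  by case: a1 a2 le => [a1|] [a2|] //= le; rewrite someE; case: eqP => /=; lia.
case: eqP => [eb|_] //; subst b.
case: a1 a2 le ab => [a1|] [a2|] //=; rewrite someE; lia.
Qed.

Lemma step_desc (R d1 d2 : bool) (a1 a2 b : option nat) :
  (d1 -> [/\ a1 = None, b = None & a2 <> None]) ->
  (d2 -> a2 = None /\ step R d1 b a1 = None) ->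
  lt_opt a1 a2 -> lt_opt (step R d1 a1 b) (step R d2 a2 (step R d1 b a1)).
Proof.
rewrite /step; case: R => //; case: d1 => [/(_ isT)[-> _ a2N]|_].
  case: d2 => [/(_ isT)[]//|_]; case: a2 a2N => // a2 _ _ /=.
  by rewrite someE; case: eqP => [->|] //=; lia.
case: d2 => [/(_ isT)[-> _]|_]; first by case: a1 => // _; case: b.
rewrite [b == a1]eq_sym; case: (eqVneq a1 b) => [<-|ab] le.
  case: a1 a2 le => [a1|] [a2|] //= le; rewrite someE; case: eqP => /=; lia.
by case: eqP => [eb|_] //; case: a1 a2 le {eb ab} => [a1|] [a2|] //=; lia.
Qed.

Section Neighbours.
Variable x : nat.
Hypothesis hx : h x = h x.+1.

Lemma dot_right y : dot x.+1 y -> edge y x.+1 = None.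
Proof. by rewrite dotC => /dot_edge. Qed.

Lemma edge_asc y : t x < t x.+1 -> le_opt (edge x.+1 y) (edge x y).
Proof.
move=> lt; elim: y => [|y IH]; first by rewrite edge0.
have eb : edge y x.+1 = step (y < h x) (dot x y) (edge y x) (edge x y).
  by rewrite edgeS dotC hsym.
rewrite (edgeS x.+1) (edgeS x y) -hx eb; apply: step_asc => // d.
  by rewrite !dot_edge // dotC.
rewrite -eb; split; [exact: dot_edge|split; last exact: dot_right].
case/andP: d => yh /eqP ty; apply/eqP; rewrite edge_None negbK; lia.
Qed.

Lemma edge_desc y : t x.+1 < t x -> lt_opt (edge x y) (edge x.+1 y).
Proof.
move=> lt; elim: y => [|y IH]; first by rewrite edge0.
have eb : edge y x.+1 = step (y < h x) (dot x y) (edge y x) (edge x y).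
  by rewrite edgeS dotC hsym.
rewrite (edgeS x.+1) (edgeS x y) -hx eb; apply: step_desc => // d.
  split; [exact: dot_edge|by rewrite dot_edge // dotC|].
  case/andP: d => yh /eqP ty; apply/eqP; rewrite edge_None negbK; lia.
by rewrite -eb dot_edge // dot_right.
Qed.

(** Of the two columns, the one with the higher 1 has the larger label wherever both
    have one, strictly so if it is the second: the local rule preserves both
    orders. *)
Lemma word_desc a b : bword x = Some a -> bword x.+1 = Some b ->
  (t x.+1 < t x) = (a < b).
Proof.
rewrite /bword -hx => wa wb; case: (ltngtP (t x.+1) (t x)) => [lt|lt|e].
- by have := edge_desc (h x) lt; rewrite wa wb => /= ->.
- by have := edge_asc (h x) lt; rewrite wa wb /=; lia.
- by have := can_inj tK e; lia.
Qed.

End Neighbours.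

(** * Increasing chains *)

Lemma vertSr r x y : vert r x y.+1 = vert r x y + (edge y x == Some r).
Proof. by rewrite vertC vertS vertC. Qed.

Lemma vert_le r x y x' y' : x <= x' -> y <= y' -> vert r x y <= vert r x' y'.
Proof.
have mono z : {homo vert r ^~ z : a b / a <= b}.
  by apply: homo_leq => // [|a]; [exact: leq_trans|rewrite vertS leq_addr].
by move=> xx yy; apply: leq_trans (mono y _ _ xx) _; rewrite !(vertC _ x') mono.
Qed.

Lemma dot_vert x y : dot x y -> vert 0 x.+1 y.+1 = (vert 0 x y).+1.
Proof.
move=> d; rewrite vertS vertSr edge_dot // [edge y x]dot_edge ?addn1 ?addn0 //.
by rewrite dotC.
Qed.

(** At a minimal corner whose first row exceeds [m], both edges towards it carry
    row 0, and that happens only at a 1. *)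
Lemma vert_dot x y m : closed x y -> m < vert 0 x y ->
  exists x' y', [/\ dot x' y', x' < x, y' < y & m <= vert 0 x' y'].
Proof.
have [n] := ubnP (x + y); elim: n x y => // n IH x y xy cl mv.
case: x xy cl mv => [|x] xy cl mv; first by rewrite /vert big_ord0 in mv.
case: y xy cl mv => [|y] xy cl mv; first by rewrite vert0 in mv.
case: (ltnP m (vert 0 x y.+1)) => m1.
  have [|||x' [y' [d x1 y1 mv']]] := IH x y.+1; [lia|by apply: closed_le cl|by []|].
  by exists x', y'; split=> //; lia.
case: (ltnP m (vert 0 x.+1 y)) => m2.
  have [|||x' [y' [d x1 y1 mv']]] := IH x.+1 y; [lia|by apply: closed_le cl|by []|].
  by exists x', y'; split=> //; lia.
have yh : y < h x by rewrite /closed /= in cl.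
exists x, y; rewrite !leqnn.
have bot : edge x y.+1 == Some 0.
  by move: mv; rewrite vertS; case: eqP => // _; lia.
have right : edge y x.+1 == Some 0.
  by move: mv; rewrite vertSr; case: eqP => // _; lia.
have d : dot x y by rewrite -level0 /level yh bot.
by split=> //; move: mv; rewrite dot_vert.
Qed.

Definition inc_occ k := exists s, [/\ size s = k, sorted ltn s,
  sorted ltn (map t s) & t (last 0 s) < h (last 0 s)].

Lemma inc_vert k : inc_occ k.+1 -> exists x y, y < h x /\ k < vert 0 x.+1 y.+1.
Proof.
case=> s [sz s1 s2 sh]; exists (last 0 s), (t (last 0 s)); split=> //.
rewrite -sz; elim/last_ind: s {sz} s1 s2 sh => [|s z IH] //.
rewrite last_rcons size_rcons => s1 s2 zh.
have d : dot z (t z) by rewrite /dot zh eqxx.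
rewrite dot_vert // ltnS; case: s IH s1 s2 => [//|z0 s] IH.
rewrite map_rcons /= !rcons_path => /andP[s1 l1] /andP[s2 l2].
rewrite last_map in l2.
apply: leq_trans (IH s1 s2 _) (vert_le _ l1 l2).
by apply: shape_in zh; rewrite ltnW.
Qed.

Lemma vert_inc k x y : closed x y -> k <= vert 0 x y -> exists s,
  [/\ size s = k, sorted ltn s, sorted ltn (map t s)
     & {in s, forall z, z < x /\ t z < y}].
Proof.
elim: k x y => [|k IH] x y cl kv; first by exists [::].
have [x' [y' [d xx yy kv']]] := vert_dot cl kv.
have cl' : closed x' y' by apply: closed_le cl; apply: ltnW.
have [s [sz s1 s2 bd]] := IH _ _ cl' kv'.
case/andP: d => _ /eqP ty; exists (rcons s x'); split.
- by rewrite size_rcons sz.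
- case: s s1 bd {sz s2} => //= z s s1 bd; rewrite rcons_path s1 /=.
  by case: (bd (last z s)) => //; apply: mem_last.
- rewrite map_rcons; case: s s2 bd {sz s1} => //= z s s2 bd.
  rewrite rcons_path s2 /= last_map ty.
  by case: (bd (last z s)) => //; apply: mem_last.
- move=> z; rewrite mem_rcons inE => /predU1P[->|/bd[]]; last by lia.
  by rewrite ty.
Qed.

(** The column, instead of the row, of the cell added at column [x]. *)
Definition tword (x : nat) : option nat :=
  if bword x is Some r then Some (vert r x (h x)) else None.

Lemma closed_top x : closed x.+1 (h x).
Proof. by rewrite /closed /=; case: (h x) => //= y; rewrite leqnn. Qed.

Lemma vert0_max r x y : closed x y -> vert r x y <= vert 0 x y.
Proof.
by move=> cl; elim: r => // r; apply: leq_trans (vert_partition _ cl).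
Qed.

(** The first row reaches length [k + 1] on the boundary exactly when a cell is
    added there in column [k]. *)
Lemma inc_occP k : inc_occ k.+1 <-> exists x c, tword x = Some c /\ k <= c.
Proof.
split=> [/inc_vert[x0 [y0 [yh kv]]]|[x [c [tx kc]]]].
  have ex : exists x, k < vert 0 x.+1 (h x).
    by exists x0; apply: leq_trans kv (vert_le _ _ _).
  case: (ex_minnP ex) => x kx xmin; exists x.
  have kx' : vert 0 x (h x) <= k.
    case: x xmin {kx} => [|x] xmin; first by rewrite /vert big_ord0.
    apply: leq_trans (_ : vert 0 x.+1 (h x) <= _).
      by apply: vert_le => //; apply: shape_anti.
    by rewrite leqNgt; apply/negP => /xmin; rewrite ltnn.
  move: kx; rewrite vertS -/(bword x) /tword.
  case: eqP => [->|_] kx; last by lia.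
  by exists (vert 0 x (h x)); split=> //; lia.
move: tx; rewrite /tword; case wx : (bword x) => [r|] // [cE].
have kv : k < vert 0 x.+1 (h x).
  apply: leq_trans (vert0_max r (closed_top x)).
  by rewrite vertS -/(bword x) wx eqxx addn1 cE.
have [s [sz s1 s2 bd]] := vert_inc (closed_top x) kv.
exists s; split=> //; have /bd[lx lt] : last 0 s \in s.
  by case: s sz {bd s1 s2} => // z s _; apply: mem_last.
by apply: leq_trans lt (shape_anti _).
Qed.

(** * Words of fillings *)

Variable n : nat.
Hypothesis hle : forall i, h i <= n.

Lemma shape_out x y : n <= x -> (y < h x) = false.
Proof.
by move=> nx; apply/negbTE; rewrite hsym -leqNgt; apply: leq_trans (hle _) nx.
Qed.

Definition cnt (w : nat -> option nat) (x r : nat) := \sum_(i < x) (w i == @Some nat r).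

Lemma cnt0 w r : cnt w 0 r = 0.
Proof. by rewrite /cnt big_ord0. Qed.

Lemma cntS w x r : cnt w x.+1 r = cnt w x r + (w x == @Some nat r).
Proof. by rewrite /cnt big_ord_recr. Qed.

Lemma cnt_le w x y r : x <= y -> cnt w x r <= cnt w y r.
Proof.
have mono : {homo cnt w ^~ r : a b / a <= b}.
  by apply: homo_leq => // [|a]; [exact: leq_trans|rewrite cntS leq_addr].
exact: mono.
Qed.

Lemma eq_cnt w w' x r : {in gtn x, w =1 w'} -> cnt w x r = cnt w' x r.
Proof. by move=> ww; apply: eq_bigr => i _; rewrite ww ?inE. Qed.

(** The corners of the grid on the boundary of the shape. *)
Definition bdry x y := [&& x <= n, y <= n, h x <= y & closed x y].

(** Row [r] of the partition that the word puts at a corner of the boundary: going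
    along the boundary from the lower left end, the columns before [x] have added
    their cells and the rows from [y] on have removed theirs. *)
Definition wpart w x y r := cnt w x r + cnt w y r - cnt w n r.

(** The letters of [w] describe a walk through partitions along the boundary. *)
Definition valid (w : nat -> option nat) :=
  [/\ forall x r, x < n -> w x = Some r -> r < n,
      forall x y r, bdry x y -> cnt w n r <= cnt w x r + cnt w y r
    & forall x y r, bdry x y -> wpart w x y r.+1 <= wpart w x y r].

Lemma bdryC x y : bdry x y = bdry y x.
Proof.
rewrite /bdry (closedC x y) [h x <= y]leqNgt [h y <= x]leqNgt hsym.
by rewrite andbCA.
Qed.

Lemma wpartC w x y r : wpart w x y r = wpart w y x r.
Proof. by rewrite /wpart [cnt w x r + _]addnC. Qed.

(** Outside of the shape labels are constant, so the sums defining [vert] can be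
    continued up to the border of the grid. *)
Lemma vert_word r x y : bdry x y ->
  vert r x y + cnt bword n r = cnt bword x r + cnt bword y r.
Proof.
case/and4P=> xn yn hxy _.
have run m : x <= m -> vert r m y + cnt bword x r = vert r x y + cnt bword m r.
  elim: m => [|m IH]; first by rewrite leqn0 => /eqP->.
  rewrite leq_eqVlt => /predU1P[<-//|]; rewrite ltnS => xm.
  rewrite vertS cntS edge_word; last exact: leq_trans (shape_anti xm) hxy.
  by have := IH xm; lia.
have -> : cnt bword y r = vert r n y.
  rewrite vertC; apply: eq_bigr => i _; by rewrite edge_word.
by have := run _ xn; lia.
Qed.

Lemma wpart_word r x y : bdry x y -> wpart bword x y r = vert r x y.
Proof. by move=> b; rewrite /wpart -vert_word // addnK. Qed.

Lemma word_valid : valid bword.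
Proof.
split.
- by move=> x r _ /edge_lt rh; apply: leq_trans rh (hle x).
- by move=> x y r b; rewrite -vert_word // leq_addl.
- move=> x y r b; rewrite !wpart_word //; apply: vert_partition.
  by case/and4P: b.
Qed.

Lemma word_None x : (bword x == None) = ~~ (t x < h x).
Proof. by rewrite /bword edge_None andbb. Qed.

End Growth.

(** * From words back to fillings *)

Section Backward.
Variables (h : nat -> nat) (n : nat).
Hypothesis hsym : forall i j, (j < h i) = (i < h j).
Hypothesis hle : forall i, h i <= n.

(** The inverse of the local rule: [a] leaves a square below, [b] to the right, and
    the result is the label above. *)
Definition bstep (inR : bool) (a b : option nat) : option nat :=
  if inR && (a == b) then (if a is Some r.+1 then Some r else None) else a.

Fixpoint back (w : nat -> option nat) (m x y : nat) : option nat :=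
  if n <= y then w x
  else if m is m'.+1 then
    bstep (y < h x) (back w m' x y.+1) (back w m' y x.+1)
  else None.

Definition bedge w x y := back w (n + n - (x + y)) x y.

Lemma bedge_n w x y : n <= y -> bedge w x y = w x.
Proof. by rewrite /bedge; case: (n + n - _) => [|m] /= ->. Qed.

Lemma bedgeE w x y : x < n -> y < n ->
  bedge w x y = bstep (y < h x) (bedge w x y.+1) (bedge w y x.+1).
Proof.
move=> xn yn; rewrite {1}/bedge.
have -> : n + n - (x + y) = (n + n - (x + y.+1)).+1 by lia.
rewrite /= leqNgt yn /=.
by rewrite /bedge (_ : x + y.+1 = y + x.+1) //; lia.
Qed.

Lemma bedge_out w x y : x < n -> h x <= y -> bedge w x y = w x.
Proof.
move=> xn; case: (ltnP y n) => yn; last by rewrite bedge_n.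
move: yn; have [m] := ubnP (n - y); elim: m y => // m IH y ym yn hy.
rewrite bedgeE // /bstep ltnNge hy /=.
case: (ltnP y.+1 n) => yn'; last by rewrite bedge_n.
by rewrite IH //; lia.
Qed.

Lemma edge_bedge t x y : involutive t -> x < n -> y <= n ->
  edge h t x y = bedge (bword h t) x y.
Proof.
move=> tK; have [m] := ubnP (n + n - (x + y)); elim: m x y => // m IH x y.
move=> xym xn; rewrite leq_eqVlt => /predU1P[->|yn].
  by rewrite bedge_n // edge_word.
rewrite bedgeE // -!IH //; try lia.
rewrite /bstep; case: (ltnP y (h x)) => yh; last by rewrite edge_out.
case: (crossP hsym tK yh) => //= [r|a b /negPf->//].
by rewrite eqxx.
Qed.

Lemma word_inj t1 t2 : involutive t1 -> involutive t2 ->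
  {in gtn n, bword h t1 =1 bword h t2} ->
  forall x, t1 x < h x -> t2 x = t1 x.
Proof.
move=> t1K t2K ww x xh; set y := t1 x in xh *.
have bb x' y' : x' < n -> bedge (bword h t1) x' y' = bedge (bword h t2) x' y'.
  have [m] := ubnP (n + n - (x' + y')); elim: m x' y' => // m IH x' y' xym xn.
  case: (ltnP y' n) => yn; last by rewrite !bedge_n // ww.
  by rewrite (bedgeE _ xn yn) [RHS]bedgeE // !IH //; lia.
have xn : x < n by rewrite ltnNge; apply/negP => /(shape_out hsym hle y); rewrite xh.
have yn : y < n by apply: leq_trans xh (hle x).
have : level h t1 0 x y by rewrite level0 // /dot xh eqxx.
rewrite /level !edge_bedge // !bb // -!edge_bedge // => l.
have : level h t2 0 x y by [].
by rewrite level0 // => /andP[_ /eqP].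
Qed.

Section Word.
Variable w : nat -> option nat.
Hypothesis wvalid : valid h n w.

Definition bdot x y :=
  [&& y < h x, bedge w x y.+1 == Some 0 & bedge w y x.+1 == Some 0].

Lemma bdotC x y : bdot x y = bdot y x.
Proof. by rewrite /bdot hsym [X in _ && X]andbC. Qed.

Lemma in_lt x y : y < h x -> x < n /\ y < n.
Proof.
move=> yh; split; last exact: leq_trans yh (hle x).
by move: yh; rewrite hsym => xh; apply: leq_trans xh (hle y).
Qed.

Variant bcross_spec (x y : nat) :
    option nat -> option nat -> option nat -> option nat -> bool -> Type :=
 | BCrossDot : bcross_spec x y None None (Some 0) (Some 0) true
 | BCrossNone : bcross_spec x y None None None None false
 | BCrossEq r : bcross_spec x y (Some r) (Some r) (Some r.+1) (Some r.+1) false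
 | BCrossNeq a b of a != b : bcross_spec x y a b a b false.

Lemma bcrossP x y : y < h x -> bcross_spec x y (bedge w x y) (bedge w y x)
  (bedge w x y.+1) (bedge w y x.+1) (bdot x y).
Proof.
move=> yh; have [xn yn] := in_lt yh; have xh : x < h y by rewrite -hsym.
rewrite (bedgeE _ xn yn) (bedgeE _ yn xn) /bdot yh xh /bstep /=.
case: (eqVneq (bedge w x y.+1)) => [<-|ne]; last first.
  rewrite (_ : _ && _ = false); first by constructor.
  by apply/negbTE; apply: contra ne => /andP[/eqP-> /eqP->].
by rewrite andbb; case: (bedge w x y.+1) => [[|r]|] /=; constructor.
Qed.

Lemma bedge_step x y : x < n -> y < n ->
  bedge w x y.+1 = step (y < h x) (bdot x y) (bedge w x y) (bedge w y x).
Proof.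
move=> xn yn; rewrite /step; case: (ltnP y (h x)) => yh; last first.
  by rewrite [RHS]bedgeE // /bstep ltnNge yh.
by case: (bcrossP yh) => //= [r|a b /negPf->//]; rewrite eqxx.
Qed.

(** The partition at the corner [(x, y)] has [cnt w y r - bsum r x y] cells in row
    [r]: from the right border of the grid, walk left at height [y] and remove the
    cells met. *)
Definition bsum r x y := \sum_(x <= i < n) (bedge w i y == @Some nat r).

Lemma bsumE r x y : x < n -> bsum r x y = (bedge w x y == @Some nat r) + bsum r x.+1 y.
Proof. by move=> xn; rewrite /bsum big_ltn. Qed.

Lemma bsum_n r y : bsum r n y = 0.
Proof. by rewrite /bsum big_geq. Qed.

Lemma bsum_out r x y : x <= n -> h x <= y -> bsum r x y + cnt w x r = cnt w n r.
Proof.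
move=> xn hy.
have [m e] : exists m, n = x + m by exists (n - x); lia.
have -> : bsum r x y = \sum_(x <= i < n) (w i == @Some nat r).
  rewrite /bsum big_nat_cond [RHS]big_nat_cond; apply: eq_bigr => i.
  rewrite andbT => /andP[xi in_]; rewrite bedge_out //.
  exact: leq_trans (shape_anti hsym xi) hy.
by rewrite /cnt -!(big_mkord xpredT (fun i => nat_of_bool (w i == @Some nat r))) addnC
  -big_cat_nat.
Qed.

Lemma bsumC r x y : x <= n -> y <= n ->
  cnt w y r + bsum r y x = cnt w x r + bsum r x y.
Proof.
have [m] := ubnP (n + n - (x + y)); elim: m x y => // m IH x y xym.
rewrite leq_eqVlt => /predU1P[->|xn].
  by move=> yn; rewrite bsum_n addn0 addnC bsum_out.
rewrite leq_eqVlt => /predU1P[->|yn].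
  by rewrite bsum_n addn0 [RHS]addnC bsum_out // ltnW.
rewrite (bsumE _ _ xn) (bsumE _ _ yn).
have e1 := IH x.+1 y ltac:(lia) xn (ltnW yn).
have e2 := IH x y.+1 ltac:(lia) (ltnW xn) yn.
have e3 := IH x.+1 y.+1 ltac:(lia) xn yn.
rewrite (bsumE _ _ yn) cntS in e1; rewrite (bsumE _ _ xn) cntS in e2.
rewrite !cntS in e3.
have key : (bedge w x y == @Some nat r) + (bedge w y x.+1 == @Some nat r) =
           (bedge w y x == @Some nat r) + (bedge w x y.+1 == @Some nat r); last first.
  by clear -e1 e2 e3 key; lia.
case: (ltnP y (h x)) => yh; last first.
  have xh : (x < h y) = false by rewrite -hsym ltnNge yh.
  by rewrite [bedge w x y]bedgeE // [bedge w y x]bedgeE // /bstep xh ltnNge yh /= addnC.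
by case: (bcrossP yh) => *; rewrite ?someE; lia.
Qed.

(** From three corners of a square with partitions, the backward rule reaches a
    partition: either both middle ones differ and it is their intersection, or they
    agree, and as the cell added in row [r + 1] fits under their row [r], that row
    can lose its last cell. *)
Lemma bsum_partition x y : x <= n -> y <= n -> closed h x y -> forall r,
  bsum r x y <= cnt w y r /\
  cnt w y r.+1 + bsum r x y <= cnt w y r + bsum r.+1 x y.
Proof.
have [m] := ubnP (n + n - (x + y)); elim: m x y => // m IH x y xym xn yn cl r.
case: (ltnP y (h x)) => yh; last first.
  have b : bdry h n x y by apply/and4P.
  have [_ v1 v2] := wvalid; move: (v1 _ _ r b) (v1 _ _ r.+1 b) (v2 _ _ r b).
  by rewrite /wpart -!(bsum_out _ xn yh); lia.
have [{}xn {}yn] := in_lt yh.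
have c3 : closed h x.+1 y.+1 by rewrite /closed /= yh.
have IH1 := IH x.+1 y ltac:(lia) xn (ltnW yn) (closed_le hsym (leqnn _) (leqnSn _) c3).
have IH2 := IH x y.+1 ltac:(lia) (ltnW xn) yn (closed_le hsym (leqnSn _) (leqnn _) c3).
have IH3 := IH x.+1 y.+1 ltac:(lia) xn yn c3.
have e1 r' : bsum r' x.+1 y + (bedge w x y == @Some nat r') = bsum r' x y.
  by rewrite (bsumE _ _ xn) addnC.
have e2 r' : bsum r' x y.+1 = (bedge w x y.+1 == @Some nat r') + bsum r' x.+1 y.+1.
  by rewrite (bsumE _ _ xn).
have e3 r' : cnt w y r' + (bedge w y x.+1 == @Some nat r') + bsum r' x.+1 y.+1 =
             cnt w y.+1 r' + bsum r' x.+1 y.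
  have := bsumC r' xn yn; have := bsumC r' xn (ltnW yn).
  by rewrite (bsumE _ _ yn) !cntS; lia.
have [p1 q1] := IH1 r; have [p1' _] := IH1 r.+1.
have [p2 q2] := IH2 r; have [p2' _] := IH2 r.+1.
have [p3 q3] := IH3 r; have [p3' _] := IH3 r.+1.
move: (e1 r) (e1 r.+1) (e2 r) (e2 r.+1) (e3 r) (e3 r.+1).
clear -p1 q1 p1' p2 q2 p2' p3 q3 p3' yh hsym hle.
case: (bcrossP yh) => [||r'|a b ab]; rewrite ?someE ?noneE.
- by lia.
- by lia.
- by lia.
have ne s : ~~ ((a == @Some nat s) && (b == @Some nat s)).
  by apply: contra ab => /andP[/eqP-> /eqP->].
have dis (c : option nat) : ~~ ((c == @Some nat r) && (c == @Some nat r.+1)).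
  by case: c => // c; rewrite !someE; lia.
by move: (ne r) (ne r.+1) (dis a) (dis b); lia.
Qed.

(** The partition at the upper border has no cell and cannot lose one. *)
Lemma bedge0 x : x < n -> bedge w x 0 = None.
Proof.
move=> xn; case e : (bedge w x 0) => [r|] //.
have cl : closed h x 0 by rewrite /closed orbT.
have [+ _] := bsum_partition (ltnW xn) (leq0n n) cl r.
by rewrite bsumE // e eqxx /cnt big_ord0.
Qed.

Lemma bedge_dot x y : bdot x y -> bedge w x y = None.
Proof.
move=> d; have yh : y < h x by case/andP: d.
by case: (bcrossP yh) d.
Qed.

Lemma bedge_None x y : x < n -> y <= n ->
  (bedge w x y == None) = ~~ has (bdot x) (iota 0 y).
Proof.
move=> xn; elim: y => [|y IH] yn; first by rewrite bedge0.
have {IH} := IH (ltnW yn); rewrite -addn1 iotaD has_cat /= add0n orbF addn1.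
rewrite negb_or => <-; rewrite bedge_step // /step.
case: (ltnP y (h x)) => yh; last by rewrite /bdot ltnNge yh andbT.
by case: (bcrossP yh) => //= [r|a b /negPf->]; rewrite ?eqxx ?andbT.
Qed.

Lemma bdot_uniq x y y' : bdot x y -> bdot x y' -> y = y'.
Proof.
wlog yy : y y' / y < y' => [W|] d d'.
  by case: (ltngtP y y') => // yy; [exact: W|symmetry; exact: W].
have /in_lt[xn yn] : y' < h x by case/andP: d'.
have := bedge_None xn (ltnW yn); rewrite bedge_dot // => /esym/negP[].
by apply/hasP; exists y; rewrite ?mem_iota.
Qed.

(** Going up a column of the backward diagram, its letter has to vanish before the
    upper border, and this happens at a 1. *)
Lemma word_surj t0 : involutive t0 ->
  {in gtn n, forall x, (w x == None) = ~~ (t0 x < h x)} ->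
  exists t, [/\ involutive t, forall x, (t x < h x) = (t0 x < h x),
    forall x, ~~ (t0 x < h x) -> t x = t0 x & {in gtn n, bword h t =1 w}].
Proof.
move=> t0K wN.
pose t x := if t0 x < h x then head 0 [seq y <- iota 0 n | bdot x y] else t0 x.
have tdot x : t0 x < h x -> bdot x (t x).
  move=> xh; have [xn _] := in_lt xh.
  have := wN x xn; rewrite xh /= -(bedge_n w x (leqnn n)) bedge_None // has_filter.
  move/negbFE; rewrite /t xh; case E : (filter _ _) => [|y s] //= _.
  have : y \in [seq y <- iota 0 n | bdot x y] by rewrite E mem_head.
  by rewrite mem_filter => /andP[].
have dott x y : bdot x y -> t0 x < h x /\ t x = y.
  move=> d; have [xn yn] := in_lt (proj1 (andP d)).
  suff xh : t0 x < h x by split=> //; apply: bdot_uniq (tdot _ xh) d.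
  apply: negbNE; rewrite -wN // -(bedge_n w x (leqnn n)) bedge_None // negbK.
  by apply/hasP; exists y; rewrite ?mem_iota.
have tS x : (t x < h x) = (t0 x < h x).
  case: (boolP (t0 x < h x)) => xh; first by case/andP: (tdot _ xh).
  by rewrite /t (negPf xh) (negPf xh).
have tN x : ~~ (t0 x < h x) -> t x = t0 x by rewrite /t => /negPf->.
have tK : involutive t.
  move=> x; case: (boolP (t0 x < h x)) => xh.
    by have := tdot _ xh; rewrite bdotC => /dott[].
  by rewrite (tN _ xh) tN t0K // -hsym.
exists t; split=> // x xn; rewrite -(edge_word t (hle x)).
rewrite -(bedge_n w x (leqnn n)).
suff E x' y : x' < n -> y <= n -> edge h t x' y = bedge w x' y by apply: E.
have [m] := ubnP (x' + y); elim: m x' y => // m IH x' [|y] xym xn' yn.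
  by rewrite edge0 bedge0.
rewrite edgeS bedge_step // !IH //; try lia.
congr step; rewrite /dot; apply/andP/idP => [[yh /eqP ty]|d].
  by rewrite -ty; apply: tdot; rewrite -tS ty.
by have [_ ->] := dott _ _ d; rewrite eqxx; case/andP: d.
Qed.

End Word.
End Backward.

(** * Transposing the partitions of a word *)

Section Transpose.
Variables (h : nat -> nat) (n : nat).
Hypothesis hsym : forall i j, (j < h i) = (i < h j).
Hypothesis hle : forall i, h i <= n.

Lemma bdry_top x : x <= n -> bdry h n x (h x).
Proof.
move=> xn; rewrite /bdry xn hle leqnn /=.
exact: (closed_le hsym (leqnSn x) (leqnn _) (closed_top h x)).
Qed.

Lemma bdry_topS x : x < n -> bdry h n x.+1 (h x).
Proof. by move=> xn; rewrite /bdry xn hle (shape_anti hsym) ?closed_top. Qed.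

Definition trw (w : nat -> option nat) x :=
  if w x is Some r then Some (wpart n w x (h x) r) else None.

Definition twpart w x y c := \sum_(r < n) (c < wpart n w x y r).

Section Valid.
Variable w : nat -> option nat.
Hypothesis wvalid : valid h n w.

Lemma wpart_anti x y r s : bdry h n x y -> r <= s -> wpart n w x y s <= wpart n w x y r.
Proof.
have [_ _ v] := wvalid => b; apply: (homo_leq (f := fun i => wpart n w x y i)
  (r := fun a b => b <= a)) => // [a b' c ab|r']; last exact: v.
by move=> ca; apply: leq_trans ca ab.
Qed.

Lemma wpartS x r : x < n ->
  wpart n w x.+1 (h x) r = wpart n w x (h x) r + (w x == Some r).
Proof.
move=> xn; have [_ v _] := wvalid.
have := v _ _ r (bdry_top (ltnW xn)); have := v _ _ r (bdry_topS xn).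
by rewrite /wpart cntS; lia.
Qed.

Lemma twpartS x c : x < n ->
  twpart w x.+1 (h x) c = twpart w x (h x) c + (trw w x == Some c).
Proof.
move=> xn; rewrite /trw; case wx : (w x) => [r|]; last first.
  by rewrite addn0; apply: eq_bigr => s _; rewrite wpartS // wx addn0.
have [vb _ _] := wvalid; have rn := vb _ _ xn wx.
rewrite /twpart (bigD1 (Ordinal rn)) //= [in RHS](bigD1 (Ordinal rn)) //=.
rewrite wpartS // wx eqxx.
rewrite (eq_bigr (fun s : 'I_n => nat_of_bool (c < wpart n w x (h x) s))).
  by rewrite someE; lia.
move=> s; rewrite -val_eqE /= => sr; rewrite wpartS // wx someE.
by rewrite eq_sym (negPf sr) addn0.
Qed.

(** Both sides gain the same cell with each column and lose the same cell with each
    row; they agree at the end [(n, 0)] of the boundary, from where the induction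
    walks back. *)
Lemma trw_cnt x y c : bdry h n x y ->
  cnt (trw w) x c + cnt (trw w) y c = twpart w x y c + cnt (trw w) n c.
Proof.
have [m] := ubnP (y + (n - x)); elim: m x y => // m IH x y xym b.
have /and4P[xn yn hxy cl] := b.
case: (ltnP (h x) y) => hy.
  (* The boundary leaves the corner upwards here, and to the right below. *)
  case: y hy b xym yn hxy cl => // y hy b xym yn hxy cl.
  have ex : x = h y.
    apply/eqP; rewrite eqn_leq [h y <= x]leqNgt -hsym -leqNgt andbC.
    rewrite -ltnS hy /=; case: x cl {b hy hxy xn xym} => // x.
    by rewrite /closed /= hsym.
  subst x; have b' : bdry h n (h y) y by rewrite bdryC // bdry_top // ltnW.
  have tl x' y' : twpart w x' y' c = twpart w y' x' c.
    by apply: eq_bigr => r _; rewrite wpartC.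
  have := IH _ _ _ b'; rewrite cntS tl [in X in _ -> X]tl twpartS //.
  by move=> e; have := e ltac:(lia); lia.
have {hy}ey : y = h x by apply/eqP; rewrite eqn_leq hy hxy.
move: xn; rewrite leq_eqVlt => /predU1P[ex|xn].
  subst x; have -> : y = 0.
    by apply/eqP; rewrite ey -leqn0 leqNgt (shape_out hsym hle).
  rewrite cnt0 addn0 /twpart big1 // => r _.
  by rewrite /wpart cnt0 addn0 subnn.
subst y; have := IH _ _ _ (bdry_topS xn); rewrite cntS twpartS //.
by move=> e; have := e ltac:(lia); lia.
Qed.

Lemma wpart_trw x y c : bdry h n x y -> wpart n (trw w) x y c = twpart w x y c.
Proof. by move=> b; rewrite /wpart trw_cnt // addnK. Qed.

Lemma trw_valid : valid h n (trw w).
Proof.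
split.
- move=> x c xn; rewrite /trw; case: (w x) => // r [<-].
  have cx : cnt w x r <= x.
    rewrite -[leqRHS]card_ord -sum1_card; apply: leq_sum => i _.
    exact: leq_b1.
  by have := cnt_le w r (hle x); rewrite /wpart; lia.
- by move=> x y c b; rewrite trw_cnt // leq_addl.
- move=> x y c b; rewrite !wpart_trw //; apply: leq_sum => r _.
  by case: (ltnP c.+1) => // /ltnW->.
Qed.

(** The new cell at the end of row [r], in column [c], finds [r] cells in that
    column: the rows before [r] are longer than [c], the others are not. *)
Lemma trwK x : x < n -> trw (trw w) x = w x.
Proof.
move=> xn; rewrite {1}/trw {1}/trw; case wx : (w x) => [r|] //; congr Some.
have [vb _ _] := wvalid; have rn := vb _ _ xn wx.
have b := bdry_top (ltnW xn); rewrite wpart_trw // /twpart.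
rewrite (eq_bigr (fun s : 'I_n => nat_of_bool (s < r))); last first.
  move=> s _; congr nat_of_bool; case: (leqP r s) => rs.
    by apply/negbTE; rewrite -leqNgt wpart_anti.
  have := wpart_anti (bdry_topS xn) (ltnW rs); rewrite !wpartS // wx eqxx someE.
  by rewrite [r == s]eq_sym (ltn_eqF rs); lia.
suff -> : \sum_(s < n) (s < r) = minn n r by lia.
by elim: (n) => [|m IH]; rewrite ?big_ord0 ?min0n // big_ord_recr /= IH; lia.
Qed.

(** A cell below the row of the one before lies in a column weakly to the left of
    it, and conversely. *)
Lemma trw_desc x a b a' b' : x.+1 < n -> h x = h x.+1 ->
  w x = Some a -> w x.+1 = Some b ->
  trw w x = Some a' -> trw w x.+1 = Some b' -> (a < b) = (b' <= a').
Proof.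
move=> xn hx wx wx1; rewrite /trw wx wx1 -hx => -[<-] [<-].
have xn' : x < n by lia.
rewrite wpartS // wx someE; case: (ltnP a b) => ab.
  by rewrite (ltn_eqF ab) addn0 wpart_anti ?bdry_top // ltnW.
have := wpart_anti (bdry_topS xn') ab; rewrite !wpartS // wx eqxx someE.
by lia.
Qed.

Lemma trw_None x : (trw w x == None) = (w x == None).
Proof. by rewrite /trw; case: (w x). Qed.

End Valid.

Lemma trw_word t x : involutive t -> x < n -> tword h t x = trw (bword h t) x.
Proof.
move=> tK xn; rewrite /tword /trw; case: (bword h t x) => // r.
by rewrite wpart_word ?bdry_top // ltnW.
Qed.

End Transpose.

(** * Hills and dales *)

(* [lia] compares atoms up to syntax; the carrier of the canonical [eqType] of
   [nat] has to be displayed as [nat] everywhere. *)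
Ltac nat_lia :=
  repeat match goal with H : _ |- _ => progress
    change (Equality.sort Datatypes_nat__canonical__eqtype_Equality) with nat in H
  end;
  change (Equality.sort Datatypes_nat__canonical__eqtype_Equality) with nat;
  lia.

Lemma geq_trans : transitive geq.
Proof. by move=> y x z; rewrite /geq /=; lia. Qed.

Lemma path_geq_all x (s : seq nat) : path geq x s = all (leq^~ x) s && sorted geq s.
Proof. by rewrite (path_sortedE geq_trans). Qed.

Lemma path_ltn_all x (s : seq nat) : path ltn x s = all (ltn x) s && sorted ltn s.
Proof. by rewrite (path_sortedE ltn_trans). Qed.

Lemma sorted_ltn_uniq (s : seq nat) : sorted ltn s -> uniq s.
Proof. by apply: sorted_uniq; [exact: ltn_trans|exact: ltnn]. Qed.

Lemma sorted_geq_eq (s s' : seq nat) :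
  sorted geq s -> sorted geq s' -> perm_eq s s' -> s = s'.
Proof. by apply: sorted_eq; [exact: geq_trans|move=> x y; rewrite /geq /=; lia]. Qed.

Lemma sorted_ltn_eq (s s' : seq nat) :
  sorted ltn s -> sorted ltn s' -> s =i s' -> s = s'.
Proof. by apply: irr_sorted_eq; [exact: ltn_trans|exact: ltnn]. Qed.

Lemma pairwise_cat_lt (T : Type) (e : rel T) (s1 s2 : seq T) :
  transitive e -> sorted e (s1 ++ s2) -> allrel e s1 s2.
Proof. by move=> et; rewrite sorted_pairwise // pairwise_cat => /andP[]. Qed.

Lemma dec_prefix (D : seq nat) j r : sorted geq D ->
  count_mem r (take j D) = 0 \/
  count_mem r.+1 (take j D) = count_mem r.+1 D.
Proof.
rewrite -{1}(cat_take_drop j D) => /(pairwise_cat_lt geq_trans)/allrelP ge.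
case: (posnP (count_mem r (take j D))) => [|rD]; [by left|right].
rewrite -[in RHS](cat_take_drop j D) count_cat (_ : count_mem _ (drop _ _) = 0) ?addn0 //.
apply/count_memPn/negP => /(ge r r.+1); rewrite -has_pred1 has_count rD.
by move=> /(_ isT); rewrite /geq /= ltnn.
Qed.

Lemma inc_prefix (S : seq nat) j r : sorted ltn S ->
  count_mem r.+1 (take j S) = 0 \/
  count_mem r (take j S) = count_mem r S.
Proof.
rewrite -{1}(cat_take_drop j S) => /(pairwise_cat_lt ltn_trans)/allrelP lt.
case: (posnP (count_mem r.+1 (take j S))) => [|rD]; [by left|right].
rewrite -[in RHS](cat_take_drop j S) count_cat (_ : count_mem _ (drop _ _) = 0) ?addn0 //.
apply/count_memPn/negP => /(lt r.+1 r); rewrite -has_pred1 has_count rD.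
by move=> /(_ isT); lia.
Qed.

Lemma take_dec (D : seq nat) r : sorted geq D ->
  exists j, take j D = [seq x <- D | r < x].
Proof.
elim: D => [|x D IH] /=; first by move=> _; exists 0.
rewrite path_geq_all => /andP[/allP xD sD]; case: (ltnP r x) => rx.
  by have [j e] := IH sD; exists j.+1; rewrite /= e.
exists 0; rewrite (eq_in_filter (a2 := pred0)) ?filter_pred0 //.
by move=> y /xD yx /=; lia.
Qed.

Lemma count_gt (D : seq nat) r :
  count_mem r.+1 [seq x <- D | r < x] = count_mem r.+1 D /\
  count_mem r [seq x <- D | r < x] = 0.
Proof.
split; first by rewrite count_filter; apply: eq_count => x /=; lia.
by apply/count_memPn; rewrite mem_filter ltnn.
Qed.

(** Cells are added to the partition [a] in the rows listed by [s]. *)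
Definition pvalid (a : nat -> nat) (s : seq nat) := forall j r,
  a r.+1 + count_mem r.+1 (take j s) <= a r + count_mem r (take j s).

Section PValid.
Variable a : nat -> nat.
Hypothesis a_part : forall r, a r.+1 <= a r.

(** The condition on the rows [r] and [r + 1] is tightest when row [r + 1] is
    complete while row [r] has only the cell of the increasing part: that moment
    occurs, just before the decreasing part reaches [r]. *)
Lemma pvalid_incdec S D : sorted ltn S -> sorted geq D ->
  pvalid a (S ++ D) <->
  forall r, a r.+1 + count_mem r.+1 (S ++ D) <= a r + (r \in S).
Proof.
move=> sS sD; have cS r : count_mem r S = (r \in S).
  by rewrite count_uniq_mem ?sorted_ltn_uniq.
split=> [v r|v j r].
  have [j e] := take_dec r sD.
  have := v (size S + j) r; rewrite take_cat ltnNge leq_addr /= addKn e.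
  by have [c1 c2] := count_gt D r; rewrite !count_cat c1 c2 !cS addn0.
have := v r; rewrite count_cat cS take_cat.
case: ltnP => jS; last first.
  rewrite !count_cat !cS.
  have : count_mem r.+1 (take (j - size S) D) <= count_mem r.+1 D.
    by rewrite -[in leqRHS](cat_take_drop (j - size S) D) count_cat leq_addr.
  by nat_lia.
case: (inc_prefix j r sS) => [->|->]; first by have := a_part r; nat_lia.
rewrite cS; have : count_mem r.+1 (take j S) <= count_mem r.+1 S.
  by rewrite -[in leqRHS](cat_take_drop j S) count_cat leq_addr.
by rewrite cS; nat_lia.
Qed.

(** Here the tightest moment is within the decreasing part, when row [r + 1] lacks
    only its cell of the increasing part and row [r] has not begun. *)
Lemma pvalid_decinc D S : sorted geq D -> sorted ltn S ->
  (forall r, a r.+1 + count_mem r.+1 (D ++ S) <= a r + count_mem r (D ++ S)) ->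
  pvalid a (D ++ S) <->
  forall r, a r.+1 + count_mem r.+1 (D ++ S) <= a r + (r.+1 \in S).
Proof.
move=> sD sS b; have cS r : count_mem r S = (r \in S).
  by rewrite count_uniq_mem ?sorted_ltn_uniq.
split=> [v r|v j r].
  have [j e] := take_dec r sD.
  have eD : take j D ++ drop j D = D by rewrite cat_take_drop.
  have jj : take (minn j (size D)) (D ++ S) = take j D.
    by rewrite takel_cat ?geq_minr // take_min take_size.
  have := v (minn j (size D)) r; rewrite jj e count_cat cS.
  by have [-> ->] := count_gt D r; nat_lia.
have := v r; have := b r; rewrite !count_cat !cS take_cat.
case: ltnP => jD; last first.
  rewrite !count_cat; case: (inc_prefix (j - size D) r sS) => [->|->]; first by nat_lia.
  have : count_mem r.+1 (take (j - size D) S) <= count_mem r.+1 S.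
    by rewrite -[in leqRHS](cat_take_drop (j - size D) S) count_cat leq_addr.
  by rewrite !cS; nat_lia.
case: (dec_prefix j r sD) => [->|->]; last by nat_lia.
have : count_mem r.+1 (take j D) <= count_mem r.+1 D.
  by rewrite -[in leqRHS](cat_take_drop j D) count_cat leq_addr.
by nat_lia.
Qed.

End PValid.

Definition consec (s : seq nat) x y :=
  [&& x \in s, y \in s, x < y & all (fun z => (z <= x) || (y <= z)) s].

Lemma consec_l s x x' y : consec s x y -> consec s x' y -> x = x'.
Proof.
move=> /and4P[xs ys xy /allP b] /and4P[xs' _ xy' /allP b'].
by have := b _ xs'; have := b' _ xs; lia.
Qed.

Lemma consec_r s x y y' : consec s x y -> consec s x y' -> y = y'.
Proof.
move=> /and4P[xs ys xy /allP b] /and4P[_ ys' xy' /allP b'].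
by have := b _ ys'; have := b' _ ys; lia.
Qed.

Lemma consec_next s x z : x \in s -> z \in s -> x < z -> exists y, consec s x y.
Proof.
move=> xs zs xz; have ex : exists y, (y \in s) && (x < y) by exists z; apply/andP.
case: (ex_minnP ex) => y /andP[ys xy] ymin; exists y; apply/and4P; split=> //.
apply/allP => u us; case: (leqP u x) => //= xu; apply: ymin; exact/andP.
Qed.

Lemma consec_prev s y z : y \in s -> z \in s -> z < y -> exists x, consec s x y.
Proof.
move=> ys zs zy; have ex : exists x, (x \in s) && (x < y) by exists z; apply/andP.
have bd x : (x \in s) && (x < y) -> x <= y by case/andP=> _ /ltnW.
case: (ex_maxnP ex bd) => x /andP[xs xy] xmax; exists x; apply/and4P; split=> //.
apply/allP => u us; case: (leqP y u) => //= [_|uy]; first by rewrite orbT.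
by rewrite orbF; apply: xmax; apply/andP.
Qed.

Lemma perm_consec s s' : perm_eq s s' -> consec s =2 consec s'.
Proof.
move=> p x y; rewrite /consec !(perm_mem p); congr [&& _, _, _ & _].
exact: perm_all.
Qed.

Definition hill (S : seq nat) (m : nat) (D : seq nat) :=
  sorted ltn (rcons S m) && sorted geq (m :: D).

Definition dale (D : seq nat) (m : nat) (S : seq nat) :=
  sorted geq (rcons D m) && sorted ltn (m :: S).

Lemma sorted_rcons_ltn S m : sorted ltn (rcons S m) = all (gtn m) S && sorted ltn S.
Proof.
by rewrite !(sorted_pairwise ltn_trans) pairwise_rcons.
Qed.

Lemma sorted_rcons_geq D m : sorted geq (rcons D m) = all (geq^~ m) D && sorted geq D.
Proof.
by rewrite !(sorted_pairwise geq_trans) pairwise_rcons.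
Qed.

Lemma hillP S m D : hill S m D ->
  [/\ sorted ltn S, sorted geq D, {in S, forall x, x < m} & {in D, forall x, x <= m}].
Proof.
rewrite /hill sorted_rcons_ltn /= path_geq_all.
by case/andP=> /andP[/allP a b] /andP[/allP c d].
Qed.

Lemma daleP D m S : dale D m S ->
  [/\ sorted ltn S, sorted geq D, {in S, forall x, m < x} & {in D, forall x, m <= x}].
Proof.
rewrite /dale sorted_rcons_geq /= path_ltn_all.
by case/andP=> /andP[/allP a b] /andP[/allP c d].
Qed.

Lemma perm_split (S s : seq nat) : uniq S -> {subset S <= s} ->
  exists R, perm_eq s (S ++ R).
Proof.
elim: S s => [|x S IH] s /=; first by exists s.
case/andP=> xS uS sub; have xs : x \in s by apply: sub; rewrite mem_head.
have [|R p] := IH (rem x s) uS.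
  move=> y yS; have yx : y != x by apply: contraNneq xS => <-.
  have : y \in s by apply: sub; rewrite inE yS orbT.
  by rewrite (perm_mem (perm_to_rem xs)) inE (negPf yx).
by exists R; apply: perm_trans (perm_to_rem xs) _; rewrite perm_cons.
Qed.

Lemma exists_max (s : seq nat) x0 : x0 \in s ->
  exists2 m, m \in s & {in s, forall x, x <= m}.
Proof.
elim: s x0 => // y [|z s] IH x0 _.
  by exists y; rewrite ?mem_head // => x; rewrite inE => /eqP->.
have [m ms mm] := IH z (mem_head _ _); case: (leqP y m) => ym.
  exists m; first by rewrite inE ms orbT.
  by move=> x; rewrite inE => /predU1P[->|/mm].
exists y; rewrite ?mem_head // => x; rewrite inE => /predU1P[->//|/mm]; lia.
Qed.

Lemma exists_min (s : seq nat) x0 : x0 \in s ->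
  exists2 m, m \in s & {in s, forall x, m <= x}.
Proof.
elim: s x0 => // y [|z s] IH x0 _.
  by exists y; rewrite ?mem_head // => x; rewrite inE => /eqP->.
have [m ms mm] := IH z (mem_head _ _); case: (leqP m y) => ym.
  exists m; first by rewrite inE ms orbT.
  by move=> x; rewrite inE => /predU1P[->|/mm].
exists y; rewrite ?mem_head // => x; rewrite inE => /predU1P[->//|/mm]; lia.
Qed.

Lemma hill_ex s S M : M \in s -> {in s, forall x, x <= M} -> M \notin S ->
  sorted ltn S -> {subset S <= s} ->
  exists m D, hill S m D /\ perm_eq s (S ++ m :: D).
Proof.
move=> Ms Mmax MS sS sub; have [R p] := perm_split (sorted_ltn_uniq sS) sub.
have pR : perm_eq R (sort geq R) by rewrite perm_sym perm_sort.
have sR : sorted geq (sort geq R) by apply: sort_sorted => x y; rewrite /geq /=; lia.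
have MR : M \in sort geq R.
  by rewrite -(perm_mem pR); move: Ms; rewrite (perm_mem p) mem_cat (negPf MS).
have p' : perm_eq s (S ++ sort geq R).
  by apply: perm_trans p _; rewrite perm_cat2l.
case: (sort geq R) sR MR p' {p pR} => // m D sR MR p; exists m, D; split=> //.
have mM : m = M.
  have := Mmax m; rewrite (perm_mem p) mem_cat mem_head orbT => /(_ isT).
  move: sR MR; rewrite /= path_geq_all inE => /andP[/allP d _].
  by case/predU1P=> [->//|/d]; lia.
rewrite /hill sR andbT sorted_rcons_ltn sS andbT; apply/allP => x xS /=.
have := Mmax _ (sub _ xS); rewrite mM leq_eqVlt => /predU1P[xM|//].
by rewrite -xM xS in MS.
Qed.

Lemma dale_ex s S M : M \in s -> {in s, forall x, M <= x} -> M \notin S ->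
  sorted ltn S -> {subset S <= s} ->
  exists D m, dale D m S /\ perm_eq s (D ++ m :: S).
Proof.
move=> Ms Mmin MS sS sub; have [R p] := perm_split (sorted_ltn_uniq sS) sub.
have pR : perm_eq R (sort geq R) by rewrite perm_sym perm_sort.
have sR : sorted geq (sort geq R) by apply: sort_sorted => x y; rewrite /geq /=; lia.
have MR : M \in sort geq R.
  by rewrite -(perm_mem pR); move: Ms; rewrite (perm_mem p) mem_cat (negPf MS).
have p' : perm_eq s (sort geq R ++ S).
  by apply: perm_trans p _; rewrite perm_catC perm_cat2r.
case/lastP: (sort geq R) sR MR p' {p pR} => // D m sR MR p; exists D, m.
rewrite -cat_rcons; split=> //.
have mM : m = M.
  have := Mmin m; rewrite (perm_mem p) mem_cat mem_rcons mem_head => /(_ isT).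
  move: sR MR; rewrite sorted_rcons_geq mem_rcons inE => /andP[/allP d _].
  by case/predU1P=> [->//|/d] /=; lia.
rewrite /dale sR /= path_ltn_all sS andbT; apply/allP => x xS /=.
have := Mmin _ (sub _ xS); rewrite mM leq_eqVlt => /predU1P[xM|//].
by rewrite xM xS in MS.
Qed.

(** Given the content, a hill is determined by the set of values in its increasing
    arm, and so is a dale; passing to the next larger value matches the two arms. *)
Definition exch (s s' : seq nat) := exists S m D D' m' S',
  [/\ s = S ++ m :: D, s' = D' ++ m' :: S', hill S m D & dale D' m' S'] /\
  perm_eq s s' /\ forall x y, consec s x y -> (x \in S) = (y \in S').

(** The increasing arm of the dale consists of the successors of the rows in the arm
    of the hill; it misses the smallest row, which is where the dale turns. *)
Lemma exch_hill S m D : hill S m D -> exists s', exch (S ++ m :: D) s'.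
Proof.
move=> hl; set s := S ++ m :: D; have [sS sD Sm Dm] := hillP hl.
pose S' := [seq y <- iota 0 m.+1 | has (fun x => (x \in S) && consec s x y) s].
have ms : m \in s by rewrite mem_cat mem_head orbT.
have [M Ms Mmin] := exists_min ms.
have sub : {subset S' <= s}.
  by move=> y; rewrite mem_filter => /andP[/hasP[x _ /andP[_ /and4P[]]]].
have sS' : sorted ltn S' by apply: sorted_filter (iota_ltn_sorted _ _); exact: ltn_trans.
have MS' : M \notin S'.
  apply/negP; rewrite mem_filter => /andP[/hasP[x _ /andP[_ /and4P[xs _ xM _]]] _].
  by have := Mmin _ xs; lia.
have [D' [m' [dl p]]] := dale_ex Ms Mmin MS' sS' sub.
exists (D' ++ m' :: S'), S, m, D, D', m', S'; split=> //; split=> // x y c.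
rewrite mem_filter; have /and4P[xs ys xy _] := c.
have ym : y <= m.
  have : y \in S ++ m :: D by [].
  by rewrite mem_cat inE => /or3P[/Sm/ltnW|/eqP->|/Dm].
rewrite mem_iota /= add0n ltnS ym andbT; apply/idP/hasP => [xS|[x' _]].
  by exists x; rewrite ?xS.
by case/andP=> xS' /(consec_l c) ->.
Qed.

Lemma exch_dale D' m' S' : dale D' m' S' -> exists s, exch s (D' ++ m' :: S').
Proof.
move=> dl; set s := D' ++ m' :: S'; have [sS sD Sm Dm] := daleP dl.
have ms : m' \in s by rewrite mem_cat mem_head orbT.
have [M Ms Mmax] := exists_max ms.
pose S := [seq x <- iota 0 M | has (fun y => (y \in S') && consec s x y) s].
have sub : {subset S <= s}.
  by move=> y; rewrite mem_filter => /andP[/hasP[x _ /andP[_ /and4P[]]]].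
have sS' : sorted ltn S by apply: sorted_filter (iota_ltn_sorted _ _); exact: ltn_trans.
have MS : M \notin S by rewrite mem_filter mem_iota add0n ltnn !andbF.
have [m [D [hl p]]] := hill_ex Ms Mmax MS sS' sub.
exists (S ++ m :: D), S, m, D, D', m', S'; split=> //; split.
  by rewrite perm_sym.
move=> x y; rewrite -(perm_consec p) => c.
rewrite mem_filter; have /and4P[xs ys xy _] := c.
have xM : x < M by apply: leq_trans xy (Mmax _ ys).
rewrite mem_iota /= add0n xM andbT; apply/hasP/idP => [[y' _]|yS'].
  by case/andP=> yS' /(consec_r c) ->.
by exists y; rewrite ?yS'.
Qed.

Lemma hill_uniq S1 m1 D1 S2 m2 D2 : hill S1 m1 D1 -> hill S2 m2 D2 ->
  perm_eq (S1 ++ m1 :: D1) (S2 ++ m2 :: D2) -> S1 =i S2 ->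
  S1 ++ m1 :: D1 = S2 ++ m2 :: D2.
Proof.
move=> /andP[l1 g1] /andP[l2 g2] p eS.
move: l1 l2; rewrite !sorted_rcons_ltn => /andP[_ l1] /andP[_ l2].
have {}eS := sorted_ltn_eq l1 l2 eS; subst S2; congr (_ ++ _).
by apply: sorted_geq_eq => //; rewrite perm_cat2l in p.
Qed.

Lemma dale_uniq S1 m1 D1 S2 m2 D2 : dale D1 m1 S1 -> dale D2 m2 S2 ->
  perm_eq (D1 ++ m1 :: S1) (D2 ++ m2 :: S2) -> S1 =i S2 ->
  D1 ++ m1 :: S1 = D2 ++ m2 :: S2.
Proof.
move=> /andP[l1 /= g1] /andP[l2 /= g2] p eS.
move: g1 g2; rewrite !path_ltn_all => /andP[_ g1] /andP[_ g2].
have {}eS := sorted_ltn_eq g1 g2 eS; subst S2.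
rewrite -!cat_rcons in p *; congr (_ ++ _).
by apply: sorted_geq_eq => //; rewrite perm_cat2r in p.
Qed.

Lemma hill_dec S1 m1 D1 S2 m2 D2 : hill S1 m1 D1 -> hill S2 m2 D2 ->
  S1 ++ m1 :: D1 = S2 ++ m2 :: D2 -> S1 = S2.
Proof.
move=> hl1 hl2 e.
have max S m D : hill S m D -> {in S ++ m :: D, forall x, x <= m}.
  move=> /hillP[_ _ Sm Dm] x.
  by rewrite mem_cat inE => /or3P[/Sm/ltnW|/eqP->|/Dm].
have m12 : m1 = m2.
  apply/eqP; rewrite eqn_leq (max _ _ _ hl2) -?e ?mem_cat ?mem_head ?orbT //.
  by rewrite (max _ _ _ hl1) // e mem_cat mem_head orbT.
have idx S m D : hill S m D -> index m (S ++ m :: D) = size S.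
  move=> /hillP[_ _ Sm _]; rewrite index_cat /= eqxx addn0.
  by case: ifP => // /Sm; rewrite ltnn.
have sz : size S1 = size S2 by rewrite -(idx _ _ _ hl1) -(idx _ _ _ hl2) e m12.
by have := congr1 (take (size S1)) e; rewrite take_size_cat // sz take_size_cat.
Qed.

Lemma dale_dec S1 m1 D1 S2 m2 D2 : dale D1 m1 S1 -> dale D2 m2 S2 ->
  D1 ++ m1 :: S1 = D2 ++ m2 :: S2 -> S1 = S2.
Proof.
move=> dl1 dl2 e.
have min D m S : dale D m S -> {in D ++ m :: S, forall x, m <= x}.
  move=> /daleP[_ _ Sm Dm] x.
  by rewrite mem_cat inE => /or3P[/Dm|/eqP->|/Sm/ltnW].
have m12 : m1 = m2.
  apply/eqP; rewrite eqn_leq (min _ _ _ dl1) ?e ?mem_cat ?mem_head ?orbT //.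
  by rewrite (min _ _ _ dl2) // -e mem_cat mem_head orbT.
have idx S m D : dale D m S -> index m (rev (D ++ m :: S)) = size S.
  move=> /daleP[_ _ Sm _]; rewrite rev_cat rev_cons cat_rcons index_cat /= eqxx.
  by rewrite mem_rev addn0 size_rev; case: ifP => // /Sm; rewrite ltnn.
have sz : size S1 = size S2 by rewrite -(idx _ _ _ dl1) -(idx _ _ _ dl2) e m12.
have := congr1 (take (size S1) \o rev) e => /=.
rewrite !rev_cat !rev_cons !cat_rcons sz.
rewrite take_size_cat ?size_rev // take_size_cat ?size_rev //.
by move/(congr1 rev); rewrite !revK.
Qed.

Lemma exch_injl s1 s2 s' : exch s1 s' -> exch s2 s' -> s1 = s2.
Proof.
case=> S1 [m1 [D1 [D1' [m1' [S1' [[e1 e1' h1 d1] [p1 c1]]]]]]].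
case=> S2 [m2 [D2 [D2' [m2' [S2' [[e2 e2' h2 d2] [p2 c2]]]]]]].
have eS' : S1' = S2' by apply: (dale_dec d1 d2); rewrite -e1' -e2'.
have p : perm_eq s1 s2 by apply: perm_trans p1 _; rewrite perm_sym.
have half (S : seq nat) m D (T : seq nat) m' D' sa sb : sa = S ++ m :: D -> hill S m D ->
    perm_eq sa sb -> (forall x y, consec sa x y -> (x \in S) = (y \in S1')) ->
    (forall x y, consec sb x y -> (x \in T) = (y \in S1')) ->
    sb = T ++ m' :: D' -> {subset S <= T}.
  move=> ea hl pa ca cb eb x xS; have [_ _ Sm _] := hillP hl.
  have [||y c] := @consec_next sa x m _ _ (Sm _ xS).
  - by rewrite ea mem_cat xS.
  - by rewrite ea mem_cat mem_head orbT.
  by rewrite (cb x y) -?(ca x y) // -(perm_consec pa).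
rewrite e1 e2 in p *; apply: hill_uniq => // x; apply/idP/idP.
  apply: (half _ _ _ _ m2 D2 _ _ erefl h1 p); rewrite -?e1 -?e2 //.
  by rewrite eS'.
rewrite perm_sym in p.
by apply: (half _ _ _ _ m1 D1 _ _ erefl h2 p); rewrite -?e1 -?e2 // eS'.
Qed.

Lemma exch_injr s s1 s2 : exch s s1 -> exch s s2 -> s1 = s2.
Proof.
case=> S1 [m1 [D1 [D1' [m1' [S1' [[e1 e1' h1 d1] [p1 c1]]]]]]].
case=> S2 [m2 [D2 [D2' [m2' [S2' [[e2 e2' h2 d2] [p2 c2]]]]]]].
have eS : S1 = S2 by apply: (hill_dec h1 h2); rewrite -e1 -e2.
have p : perm_eq s1 s2 by rewrite perm_sym in p1; apply: perm_trans p1 _.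
have half (S D' : seq nat) m' (T sa : seq nat)  :
    sa = D' ++ m' :: S -> dale D' m' S -> perm_eq s sa ->
    (forall x y, consec s x y -> (x \in S1) = (y \in S)) ->
    (forall x y, consec s x y -> (x \in S1) = (y \in T)) -> {subset S <= T}.
  move=> ea dl pa ca cb y yS; have [_ _ Sm _] := daleP dl.
  have [||x c] := @consec_prev s y m' _ _ (Sm _ yS).
  - by rewrite (perm_mem pa) ea mem_cat inE yS !orbT.
  - by rewrite (perm_mem pa) ea mem_cat mem_head orbT.
  by rewrite -(cb x y) ?(ca x y).
rewrite -eS in c2.
rewrite e1' e2' in p *; apply: dale_uniq => // x; apply/idP/idP.
  by move: x; apply: (half _ _ _ _ _ e1' d1 p1 c1 c2).
by move: x; apply: (half _ _ _ _ _ e2' d2 p2 c2 c1).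
Qed.

(** If row [r + 1] ends up longer than row [r] was before the block, both rows gain
    cells and are consecutive, so the two conditions coincide; otherwise both
    hold. *)
Lemma exch_pvalid a s s' : exch s s' -> (forall r, a r.+1 <= a r) ->
  (forall r, a r.+1 + count_mem r.+1 s <= a r + count_mem r s) ->
  pvalid a s <-> pvalid a s'.
Proof.
case=> S [m [D [D' [m' [S' [[e e' hl dl] [p c]]]]]]] ap bp.
have [sS _ _ _] := hillP hl; have [sS' _ _ _] := daleP dl.
have sD : sorted geq (m :: D) by case/andP: hl.
have sD' : sorted geq (rcons D' m') by case/andP: dl.
have cnt r : count_mem r s = count_mem r s' by apply/seq.permP.
have bp' r : a r.+1 + count_mem r.+1 s' <= a r + count_mem r s'.
  by rewrite -!cnt.
rewrite -cat_rcons in e'.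
have E r : (a r.+1 + count_mem r.+1 s <= a r + (r \in S)) =
           (a r.+1 + count_mem r.+1 s <= a r + (r.+1 \in S')).
  case: (leqP (a r.+1 + count_mem r.+1 s) (a r)) => le.
    by rewrite !(leq_trans le) ?leq_addr.
  rewrite (c r r.+1) // /consec ltnSn -!has_pred1 !has_count.
  apply/and4P; split=> //; [by have := bp r; lia|by have := ap r; lia|].
  by apply/allP => z _; lia.
split.
  rewrite e (pvalid_incdec ap sS sD) -e => v.
  by rewrite e' (pvalid_decinc sD' sS') -e' // => r; rewrite -cnt -E.
rewrite e' (pvalid_decinc sD' sS') -e' // => v.
by rewrite e (pvalid_incdec ap sS sD) -e => r; rewrite E cnt.
Qed.

(** * Rearranging a block of a word *)

Lemma hill_shape (s : seq nat) : s <> [::] ->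
  (exists S m D, s = S ++ m :: D /\ hill S m D) <->
  (forall i, i.+2 < size s ->
     ~~ ((nth 0 s i.+1 <= nth 0 s i) && (nth 0 s i.+1 < nth 0 s i.+2))).
Proof.
move=> s0; split=> [[S [m [D [-> /andP[]]]]]|].
  elim: S {s s0} => [_ /sortedP/(_ _) sD i isz|x S IH].
    by have := sD 0 i.+1 isz; rewrite /geq /=; lia.
  move=> /= xS sD [|i]; last by apply: IH => //; apply: path_sorted xS.
  move=> _; rewrite negb_and -ltnNge /=.
  by case: S xS {IH} => [|y S] /= /andP[->].
elim: s s0 => // x [|y s] IH _ noval; first by exists [::], x, [::].
have [//||S [m [D [e /andP[hS hD]]]]] := IH.
  by move=> i isz; apply: (noval i.+1).
rewrite e; case: (ltnP x y) => xy.
  exists (x :: S), m, D; split=> //; rewrite /hill hD andbT /=.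
  by case: S e hS => [|z S] [<- _] /= hS; rewrite xy ?hS.
case: S e hS => [|z S] [e1 e2] hS.
  by subst m; exists [::], x, (y :: D); rewrite /hill /= xy.
have := noval 0; rewrite /= xy e2; case: S e2 hS => [|z' S] e2 /= /andP[].
  by rewrite e1 => -> _ /(_ isT).
by rewrite e1 => -> _ /(_ isT).
Qed.

Lemma dale_shape (s : seq nat) : s <> [::] ->
  (exists D m S, s = D ++ m :: S /\ dale D m S) <->
  (forall i, i.+2 < size s ->
     ~~ ((nth 0 s i < nth 0 s i.+1) && (nth 0 s i.+2 <= nth 0 s i.+1))).
Proof.
move=> s0; split=> [[D [m [S [-> /andP[]]]]]|].
  elim: D {s s0} => [_ /sortedP/(_ _) sS i isz|x D IH].
    by have := sS 0 i.+1 isz; rewrite /=; lia.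
  move=> /= xD sS [|i]; last by apply: IH => //; apply: path_sorted xD.
  move=> _; rewrite negb_and -leqNgt /=.
  by case: D xD {IH} => [|y D] /= /andP[->].
elim: s s0 => // x [|y s] IH _ nopk; first by exists [::], x, [::].
have [//||D [m [S [e /andP[hD hS]]]]] := IH.
  by move=> i isz; apply: (nopk i.+1).
rewrite e; case: (leqP y x) => xy.
  exists (x :: D), m, S; split=> //; rewrite /dale hS andbT /=.
  by case: D e hD => [|z D] [<- _] /= hD; rewrite /geq /= xy ?hD.
case: D e hD => [|z D] [e1 e2] hD.
  by subst m; exists [::], x, (y :: S); rewrite /dale /= xy.
have := nopk 0; rewrite /= xy e2; case: D e2 hD => [|z' D] e2 /= /andP[].
  by rewrite e1 /geq /= => -> _ /(_ isT).
by rewrite e1 /geq /= => -> _ /(_ isT).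
Qed.

Definition seg (w : nat -> option nat) p q :=
  [seq odflt 0 (w i) | i <- iota p (q - p)].

Definition filled (w : nat -> option nat) p q := forall i, p <= i < q -> w i != None.

Lemma size_seg w p q : size (seg w p q) = q - p.
Proof. by rewrite size_map size_iota. Qed.

Lemma nth_seg w p q i : i < q - p -> nth 0 (seg w p q) i = odflt 0 (w (p + i)).
Proof. by move=> iq; rewrite (nth_map 0) ?size_iota // nth_iota. Qed.

Lemma cnt_seg w p x r : p <= x -> filled w p x ->
  cnt w x r = cnt w p r + count_mem r (seg w p x).
Proof.
elim: x => [|x IH]; first by rewrite leqn0 => /eqP->; rewrite /seg subnn addn0.
rewrite leq_eqVlt => /predU1P[<-|px] fl; first by rewrite /seg subnn addn0.
rewrite cntS IH //; last by move=> i ipx; apply: fl; lia.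
rewrite /seg subSn // -addn1 iotaD map_cat count_cat /= subnKC // addn0 addnA.
by case: (w x) (fl x ltac:(lia)).
Qed.

Lemma take_seg w p q j : j <= q - p -> take j (seg w p q) = seg w p (p + j).
Proof. by move=> jq; rewrite /seg -map_take take_iota addKn (minn_idPl jq). Qed.

Section Blocks.
Variables (h : nat -> nat) (n : nat).
Hypothesis hsym : forall i j, (j < h i) = (i < h j).
Hypothesis hle : forall i, h i <= n.

Definition rearr p q (w w' : nat -> option nat) :=
  [/\ perm_eq (seg w p q) (seg w' p q), filled w p q, filled w' p q
    & forall i, i < n -> ~~ (p <= i < q) -> w' i = w i].

Section OneBlock.
Variables p q : nat.
Hypotheses (pq : p < q) (qn : q <= n).
Hypothesis hpq : forall i, p <= i < q -> h i = h p.

(** Self-conjugacy keeps the corner of the boundary on the diagonal out of the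
    interior of a block, so a rearrangement does not affect the letters counted up
    to the height [h p]. *)
Lemma block_height : ~~ (p < h p < q).
Proof.
apply/negP => /andP[ph hq].
have e1 : h (h p) = h p by apply: hpq; lia.
have e2 : h (h p).-1 = h p by apply: hpq; lia.
by have := hsym (h p) (h p).-1; rewrite e1 e2; lia.
Qed.

Lemma rearr_cnt w w' x r : rearr p q w w' -> x <= n -> ~~ (p < x < q) ->
  cnt w' x r = cnt w x r.
Proof.
case=> pe f f' out xn xpq; have lo y : y <= p -> cnt w' y r = cnt w y r.
  by move=> yp; apply: eq_cnt => i /= ip; apply: out; move: ip; rewrite ?inE; lia.
case: (leqP x p) => [/lo//|px]; have qx : q <= x by lia.
elim: x qx {px xpq} xn => [|x IH]; first by lia.
rewrite leq_eqVlt => /predU1P[<- _|]; last first.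
  by rewrite ltnS => qx xn; rewrite !cntS IH ?out //; lia.
rewrite !(@cnt_seg _ p q) ?(ltnW pq) // lo //; congr (_ + _); apply/esym.
by move/seq.permP: pe => ->.
Qed.

Lemma block_bdry x : p <= x <= q -> bdry h n x (h p).
Proof.
move=> xpq; rewrite /bdry hle (_ : h x <= h p) ?(shape_anti hsym) //; try lia.
rewrite /= (_ : x <= n); last by lia.
case: (posnP x) => [->//|x0]; have [xp|px] := leqP x p.
  have -> : x = p by lia.
  exact: (closed_le hsym (leqnSn p) (leqnn _) (closed_top h p)).
have := closed_top h x.-1; rewrite prednK // hpq //; lia.
Qed.

Lemma bdry_p : bdry h n p (h p).
Proof. by apply: block_bdry; rewrite leqnn ltnW. Qed.

Lemma block_part w r : valid h n w -> wpart n w p (h p) r.+1 <= wpart n w p (h p) r.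
Proof. by move=> v; apply: (wpart_anti v) => //; apply: block_bdry; lia. Qed.

Lemma wpart_seg w j r : valid h n w -> filled w p q -> j <= q - p ->
  wpart n w (p + j) (h p) r = wpart n w p (h p) r + count_mem r (take j (seg w p q)).
Proof.
move=> [_ v _] f jq; rewrite take_seg // /wpart (@cnt_seg _ p (p + j)) ?leq_addr //.
  by have := v p (h p) r bdry_p; nat_lia.
by move=> i ij; apply: f; lia.
Qed.

Lemma valid_block w : valid h n w -> filled w p q ->
  pvalid (wpart n w p (h p)) (seg w p q).
Proof.
move=> v f j r; wlog jq : j / j <= q - p => [W|].
  case: (leqP j (q - p)) => [/W//|jq].
  have := W (q - p) (leqnn _); rewrite -[in take (q - p) _](size_seg w p q).
  by rewrite take_size take_oversize // size_seg ltnW.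
rewrite -!wpart_seg //; apply: (wpart_anti v) => //; apply: block_bdry; lia.
Qed.

Lemma block_part_end w r : valid h n w -> filled w p q ->
  wpart n w p (h p) r.+1 + count_mem r.+1 (seg w p q) <=
  wpart n w p (h p) r + count_mem r (seg w p q).
Proof.
by move=> v f; have := valid_block v f (q - p) r; rewrite take_oversize ?size_seg.
Qed.

Lemma rearr_valid w w' : valid h n w -> rearr p q w w' ->
  pvalid (wpart n w p (h p)) (seg w' p q) -> valid h n w'.
Proof.
move=> v R pv; have [v1 v2 v3] := v; have [pe f f' out] := R.
have C := rearr_cnt _ R.
have cn r : cnt w' n r = cnt w n r by apply: C; lia.
have cp r : cnt w' p r = cnt w p r by apply: C; lia.
have ch r : cnt w' (h p) r = cnt w (h p) r by apply: C => //; exact: block_height.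
have inner x y : bdry h n x y -> p < x < q -> y = h p.
  case/and4P=> xn yn hxy cl xpq; apply/eqP; rewrite eqn_leq.
  rewrite -[X in _ && (X <= _)](hpq (i := x)) ?hxy ?andbT; last by lia.
  case: x cl xpq {xn hxy} => // x; rewrite /closed /= => cl xpq.
  by have hx : h x = h p; [apply: hpq; lia|rewrite hx in cl; lia].
have good x y : bdry h n x y -> (p < x < q -> forall r,
    cnt w' n r <= cnt w' x r + cnt w' y r /\
    wpart n w' x y r.+1 <= wpart n w' x y r).
  move=> b xpq r; have ey := inner _ _ b xpq; subst y.
  have ex : x = p + (x - p) by lia.
  have bp := bdry_p.
  have cx s : cnt w' x s = cnt w p s + count_mem s (take (x - p) (seg w' p q)).
    rewrite (@cnt_seg _ p x) ?cp ?take_seg -?ex //; try lia.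
    by move=> i ipx; apply: f'; lia.
  rewrite /wpart !cx !cn !ch; move: (v2 _ _ r bp) (v2 _ _ r.+1 bp).
  by have := pv (x - p) r; rewrite /wpart; lia.
have all x y r : bdry h n x y -> cnt w' n r <= cnt w' x r + cnt w' y r /\
    wpart n w' x y r.+1 <= wpart n w' x y r.
  move=> b; case: (boolP (p < x < q)) => xpq; first exact: good.
  case: (boolP (p < y < q)) => ypq.
    rewrite addnC wpartC [wpart n w' x y r]wpartC; apply: good => //.
    by rewrite bdryC.
  have /and4P[xn yn _ _] := b.
  by rewrite /wpart !cn !(C x) // !(C y) //; split; [exact: v2|exact: v3].
split=> [x r xn wx|x y r /(all _ _ r)[]//|x y r /(all _ _ r)[]//].
case: (boolP (p <= x < q)) => xpq; last by apply: (v1 x) => //; rewrite -out.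
have : r \in seg w' p q.
  by apply/mapP; exists x; [rewrite mem_iota; lia|rewrite wx].
rewrite -(perm_mem pe) => /mapP[i]; rewrite mem_iota => ipq.
have := f i; case wi : (w i) => [r'|] // fi; last by have := fi ltac:(lia).
by move=> ->; apply: (v1 i) => //; lia.
Qed.

End OneBlock.
End Blocks.

(** * Exchanging the peaks and valleys of a block *)

Lemma leq_card_rel (X : finType) (A B : {set X}) (R : X -> X -> Prop) :
  (forall x, x \in A -> exists2 y, y \in B & R x y) ->
  (forall x1 x2 y, x1 \in A -> x2 \in A -> R x1 y -> R x2 y -> x1 = x2) ->
  #|A| <= #|B|.
Proof.
move=> ex inj.
have [f fP] : exists f, forall x, x \in A -> f x \in B /\ R x (f x).
  apply: (@fin_all_exists X (fun=> X) (fun x y => x \in A -> y \in B /\ R x y)) => x.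
  case: (boolP (x \in A)) => xA; last by exists x.
  by have [y yB Rxy] := ex x xA; exists y.
rewrite -(card_in_imset (f := f)); last first.
  move=> x1 x2 x1A x2A e; apply: (inj _ _ (f x1)) => //; first by case: (fP x1 x1A).
  by rewrite e; case: (fP x2 x2A).
by apply/subset_leq_card/subsetP => _ /imsetP[x xA ->]; case: (fP x xA).
Qed.

Section Exchange.
Variables (h : nat -> nat) (n K : nat) (S : pred nat).
Hypothesis hsym : forall i j, (j < h i) = (i < h j).
Hypothesis hle : forall i, h i <= n.

(** The words of the transversals with 1s exactly in the columns [S] of the shape
    and without decreasing chain of [K + 1] elements in it. *)
Definition good (w : nat -> option nat) :=
  [/\ valid h n w, forall x, x < n -> (w x != None) = S x
    & forall x r, x < n -> w x = Some r -> r < K].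

Definition adj x := [&& x.+1 < n, h x == h x.+1, S x & S x.+1].

(** A rise of the word is a descent of the filling. *)
Definition rise (w : nat -> option nat) x := odflt 0 (w x) < odflt 0 (w x.+1).

Definition peak_at w i := [&& 0 < i, adj i.-1, adj i, ~~ rise w i.-1 & rise w i].

Definition valley_at w i := [&& 0 < i, adj i.-1, adj i, rise w i.-1 & ~~ rise w i].

Definition upd (w : nat -> option nat) p (s : seq nat) i :=
  if p <= i < p + size s then Some (nth 0 s (i - p)) else w i.

Lemma seg_upd w p s : seg (upd w p s) p (p + size s) = s.
Proof.
apply: (@eq_from_nth _ 0); first by rewrite size_seg addKn.
move=> i; rewrite size_seg addKn => isz; rewrite nth_seg ?addKn //.
by rewrite /upd leq_addr ltn_add2l isz /= addKn.
Qed.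

Section OneBlock.
Variables p q : nat.
Hypotheses (pq : p < q) (qn : q <= n).
Hypothesis hpq : forall i, p <= i < q -> h i = h p.
Hypothesis Spq : forall i, p <= i < q -> S i.

Lemma good_filled w : good w -> filled w p q.
Proof. by case=> _ wS _ i ipq; rewrite wS ?Spq //; lia. Qed.

Definition brel (w w' : nat -> option nat) :=
  exch (seg w p q) (seg w' p q) /\
  forall i, i < n -> ~~ (p <= i < q) -> w' i = w i.

Lemma exch_perm s s' : exch s s' -> perm_eq s s'.
Proof. by case=> ? [? [? [? [? [? [_ []]]]]]]. Qed.

Lemma brel_seg w1 w2 : good w1 -> good w2 -> seg w1 p q = seg w2 p q ->
  (forall i, i < n -> ~~ (p <= i < q) -> w1 i = w2 i) ->
  {in gtn n, w1 =1 w2}.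
Proof.
move=> g1 g2 e out i /=; rewrite inE => ni.
case: (boolP (p <= i < q)) => ipq; last exact: out.
have := congr1 (nth 0 ^~ (i - p)) e => /=.
rewrite !nth_seg; try lia; rewrite subnKC; last by lia.
have := good_filled g1 ipq; have := good_filled g2 ipq.
by case: (w1 i) => // a; case: (w2 i) => //= b _ _ ->.
Qed.

Lemma brel_injl w1 w2 w : good w1 -> good w2 -> brel w1 w -> brel w2 w ->
  {in gtn n, w1 =1 w2}.
Proof.
move=> g1 g2 [e1 o1] [e2 o2]; apply: brel_seg => //.
  exact: exch_injl e1 e2.
by move=> i ni ipq; rewrite -o1 // o2.
Qed.

Lemma brel_injr w w1 w2 : good w1 -> good w2 -> brel w w1 -> brel w w2 ->
  {in gtn n, w1 =1 w2}.
Proof.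
move=> g1 g2 [e1 o1] [e2 o2]; apply: brel_seg => //.
  exact: exch_injr e1 e2.
by move=> i ni ipq; rewrite o1 // o2.
Qed.

Lemma good_upd w s : good w -> perm_eq (seg w p q) s ->
  pvalid (wpart n w p (h p)) s -> good (upd w p s) /\ seg (upd w p s) p q = s.
Proof.
move=> g pe pv; have [v wS wK] := g.
have sz : p + size s = q by rewrite -(perm_size pe) size_seg subnKC // ltnW.
have es : seg (upd w p s) p q = s by rewrite -sz seg_upd.
have out i : ~~ (p <= i < q) -> upd w p s i = w i.
  by move=> ipq; rewrite /upd sz (negPf ipq).
have ins i : p <= i < q -> upd w p s i = Some (nth 0 s (i - p)).
  by move=> ipq; rewrite /upd sz ipq.
split=> //; split.
- apply: (rearr_valid hsym hle pq qn hpq v); rewrite ?es //.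
  split=> //; [by rewrite es|exact: good_filled|by move=> i /ins->|].
  by move=> i _; apply: out.
- move=> x xn; case: (boolP (p <= x < q)) => xpq; last by rewrite out ?wS.
  by rewrite ins // Spq.
- move=> x r xn; case: (boolP (p <= x < q)) => xpq; last by rewrite out //; apply: wK.
  rewrite ins // => -[<-].
  have : nth 0 s (x - p) \in seg w p q by rewrite (perm_mem pe) mem_nth //; lia.
  case/mapP => i; rewrite mem_iota => ipq ->.
  have fi := good_filled g (i := i) ltac:(lia).
  by case wi : (w i) fi => [r'|] //= _; apply: (wK i) => //; lia.
Qed.

Lemma rise_seg w i : i.+1 < q - p ->
  rise w (p + i) = (nth 0 (seg w p q) i < nth 0 (seg w p q) i.+1).
Proof. by move=> iq; rewrite !nth_seg ?addnS //; lia. Qed.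

Lemma seg_neq0 w : seg w p q <> [::].
Proof. by move/(congr1 size); rewrite size_seg /=; lia. Qed.

(** In terms of the filling, [w] has no peak inside the block and [w'] no valley. *)
Lemma exch_forward w : good w ->
  (forall i, p <= i -> i.+2 < q -> ~~ (~~ rise w i && rise w i.+1)) ->
  exists w', [/\ good w', brel w w'
    & forall i, p <= i -> i.+2 < q -> ~~ (rise w' i && ~~ rise w' i.+1)].
Proof.
move=> g nopk.
have /(hill_shape (@seg_neq0 w))[S' [m [D [es hl]]]] : forall i,
    i.+2 < size (seg w p q) ->
    ~~ ((nth 0 (seg w p q) i.+1 <= nth 0 (seg w p q) i) &&
        (nth 0 (seg w p q) i.+1 < nth 0 (seg w p q) i.+2)).
  move=> i; rewrite size_seg => iq; have := nopk (p + i) (leq_addr _ _) ltac:(lia).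
  by rewrite -addnS !rise_seg -?leqNgt //; lia.
have [s' ex] := exch_hill hl; rewrite -es in ex.
have [v _ _] := g; have f := good_filled g.
have pv : pvalid (wpart n w p (h p)) s'.
  rewrite -(exch_pvalid ex); first exact: valid_block.
    by move=> r; apply: (block_part hsym hle pq qn hpq).
  by move=> r; apply: (block_part_end hsym hle pq qn hpq).
have [g' es'] := good_upd g (exch_perm ex) pv.
exists (upd w p s'); split=> //.
  split; first by rewrite es'.
  move=> i ni ipq; rewrite /upd -(perm_size (exch_perm ex)) size_seg subnKC ?(negPf ipq) //.
  exact: ltnW.
have [D1 _] := dale_shape (@seg_neq0 (upd w p s')); rewrite es' in D1.
have : exists D m S, s' = D ++ m :: S /\ dale D m S.
  by case: ex => ? [? [? [D' [m' [S'' [[_ -> _ dl] _]]]]]]; exists D', m', S''.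
move=> /D1 noval i pi iq.
have := noval (i - p); rewrite -(perm_size (exch_perm ex)) size_seg => /(_ ltac:(lia)).
have -> : i = p + (i - p) by lia.
rewrite -addnS !rise_seg ?es' ?addKn -?leqNgt //; lia.
Qed.

Lemma exch_backward w' : good w' ->
  (forall i, p <= i -> i.+2 < q -> ~~ (rise w' i && ~~ rise w' i.+1)) ->
  exists w, [/\ good w, brel w w'
    & forall i, p <= i -> i.+2 < q -> ~~ (~~ rise w i && rise w i.+1)].
Proof.
move=> g nopk.
have /(dale_shape (@seg_neq0 w'))[D' [m [S' [es hl]]]] : forall i,
    i.+2 < size (seg w' p q) ->
    ~~ ((nth 0 (seg w' p q) i < nth 0 (seg w' p q) i.+1) &&
        (nth 0 (seg w' p q) i.+2 <= nth 0 (seg w' p q) i.+1)).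
  move=> i; rewrite size_seg => iq; have := nopk (p + i) (leq_addr _ _) ltac:(lia).
  by rewrite -addnS !rise_seg -?leqNgt //; lia.
have [s ex] := exch_dale hl; rewrite -es in ex.
have [v _ _] := g; have f := good_filled g.
have pe : perm_eq (seg w' p q) s by rewrite perm_sym; exact: exch_perm ex.
have pv : pvalid (wpart n w' p (h p)) s.
  rewrite (exch_pvalid ex); first exact: valid_block.
    by move=> r; apply: (block_part hsym hle pq qn hpq).
  move=> r; have := block_part_end hsym hle pq qn hpq r v f.
  by move/seq.permP: pe => pe; rewrite !pe.
have [g' es'] := good_upd g pe pv.
exists (upd w' p s); split=> //.
  split; first by rewrite es'.
  move=> i ni ipq; rewrite /upd -(perm_size pe) size_seg subnKC ?(negPf ipq) //.
  exact: ltnW.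
have [D1 _] := hill_shape (@seg_neq0 (upd w' p s)); rewrite es' in D1.
have : exists S m D, s = S ++ m :: D /\ hill S m D.
  by case: ex => S1 [m1 [E1 [? [? [? [[-> _ hl1 _] _]]]]]]; exists S1, m1, E1.
move=> /D1 noval i pi iq.
have := noval (i - p); rewrite -(perm_size pe) size_seg => /(_ ltac:(lia)).
have -> : i = p + (i - p) by lia.
rewrite -addnS !rise_seg ?es' ?addKn -?leqNgt //; lia.
Qed.

End OneBlock.
End Exchange.

(** * From blocks to peak sets *)

Section Triangular.
Variable n : nat.

Definition sparse (Q : {set 'I_n}) :=
  forall i j : 'I_n, i \in Q -> j \in Q -> j != i.+1 :> nat.

(** If blocks end at the elements of [B] and have no inner peak, a peak is the last
    or the first element of a block. *)
Definition covered (B : {set 'I_n}) :=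
  [set i : 'I_n | (i \in B) || [exists j in B, i == j.+1 :> nat]].

Definition weight (Q : {set 'I_n}) := \sum_(i in Q) (n - i).

Lemma weight_proper (Q P : {set 'I_n}) : Q \proper P -> weight Q < weight P.
Proof.
case/properP => QP [i iP iQ]; rewrite /weight [X in _ < X](big_setID Q) /= (setIidPr QP).
rewrite -[X in X < _]addn0 ltn_add2l (bigD1 i) ?inE ?iQ //=.
by rewrite ltn_addr // subn_gt0.
Qed.

Lemma weight_sub (Q P : {set 'I_n}) : Q \subset P -> weight Q <= weight P.
Proof.
move=> QP; have [->//|ne] := eqVneq Q P; apply/ltnW/weight_proper.
by rewrite properEneq ne.
Qed.

(** An element of [Q] outside of [P] is the successor of one in [P], and sparseness
    makes the map back to [P] injective. *)
Lemma weight_cov (Q P : {set 'I_n}) :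
  sparse Q -> Q \subset covered P -> Q != P -> weight Q < weight P.
Proof.
move=> sQ QP ne; case: (boolP (Q \subset P)) => [sub|/subsetPn[i0 i0Q i0P]].
  by apply: weight_proper; rewrite properEneq ne.
pose s (i : 'I_n) := if i \in P then i else odflt i [pick j in P | i == j.+1 :> nat].
have sP i : i \in Q -> s i \in P /\ (s i = i \/ s i \notin Q /\ i = (s i).+1 :> nat).
  move=> iQ; rewrite /s; case: ifP => [iP|iP]; first by split=> //; left.
  have := subsetP QP _ iQ; rewrite inE iP /= => /existsP[j0 j0P].
  case: pickP => [j /andP[jP /eqP ij]|/(_ j0)]; last by rewrite /= j0P.
  split=> //; right; split=> //.
  by apply/negP => jQ; have := sQ j i jQ iQ; rewrite ij eqxx.
have inj : {in Q &, injective s}.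
  move=> i j iQ jQ e; have [_ [ei|[ni ei]]] := sP _ iQ; have [_ [ej|[nj ej]]] := sP _ jQ.
  - by rewrite -ei e.
  - by case/negP: nj; rewrite -e ei.
  - by case/negP: ni; rewrite e ej.
  - by apply: val_inj; rewrite /= ei ej e.
apply: (@leq_trans (\sum_(i in Q) (n - s i))).
  rewrite /weight (bigD1 i0) //= [X in _ < X](bigD1 i0) //= -addSn leq_add //.
    have [s0 [e|[_ e]]] := sP _ i0Q; first by rewrite -e s0 in i0P.
    by rewrite e; have := ltn_ord i0; lia.
  apply: leq_sum => i /andP[iQ _]; apply: leq_sub2l.
  by have [_ [->|[_ ->]]] := sP _ iQ.
rewrite -(big_imset (fun j : 'I_n => n - j)) //=; apply: weight_sub.
by apply/subsetP => _ /imsetP[i iQ ->]; have [] := sP _ iQ.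
Qed.

(** Among the sparse sets inside [covered P] the set [P] itself has the largest weight. *)
Lemma triangular (X : finType) (A : {set X}) (f g : X -> {set 'I_n}) :
  {in A, forall T, sparse (f T)} -> {in A, forall T, sparse (g T)} ->
  (forall B, #|[set T in A | f T \subset covered B]| =
             #|[set T in A | g T \subset covered B]|) ->
  forall P, #|[set T in A | f T == P]| = #|[set T in A | g T == P]|.
Proof.
move=> sf sg fg P; have [m] := ubnP (weight P); elim: m P => // m IH P Pm.
have split (e : X -> {set 'I_n}) : #|[set T in A | e T \subset covered P]| =
    \sum_(Q : {set 'I_n} | Q \subset covered P) #|[set T in A | e T == Q]|.
  rewrite -sum1_card (partition_big e (fun Q => Q \subset covered P)) /=; last first.
    by move=> T; rewrite inE => /andP[].
  apply: eq_bigr => Q QP; rewrite -sum1_card; apply: eq_bigl => T.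
  rewrite !inE -andbA; case: eqP => [->|_]; last by rewrite !andbF.
  by rewrite QP.
have PP : P \subset covered P by apply/subsetP => i iP; rewrite inE iP.
have := fg P; rewrite !split (bigD1 P) //= [in RHS](bigD1 P) //=.
move=> e; apply/eqP; rewrite -(eqn_add2r
  (\sum_(Q : {set 'I_n} | (Q \subset covered P) && (Q != P)) #|[set T in A | f T == Q]|)); rewrite e eqn_add2l; apply/eqP.
apply: eq_bigr => Q /andP[QP ne].
case: (posnP #|[set T in A | f T == Q]|) => f0.
  case: (posnP #|[set T in A | g T == Q]|) => [->//|].
  case/card_gt0P => T; rewrite inE => /andP[TA /eqP gT].
  apply/esym/IH; apply: (@leq_trans (weight P)) => //; apply: weight_cov => //.
  by rewrite -gT; apply: sg.
case/card_gt0P: f0 => T; rewrite inE => /andP[TA /eqP fT].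
apply/esym/IH; apply: (@leq_trans (weight P)) => //; apply: weight_cov => //.
by rewrite -fT; apply: sf.
Qed.

End Triangular.

(** * Equidistribution of peaks and valleys *)

Section Equi.
Variables (h : nat -> nat) (n K : nat) (S : pred nat).
Hypothesis hsym : forall i j, (j < h i) = (i < h j).
Hypothesis hle : forall i, h i <= n.

Local Notation good := (good h n K S).
Local Notation adj := (adj h n S).
Local Notation peak_at := (peak_at h n S).
Local Notation valley_at := (valley_at h n S).

Variables (X : finType) (A : {set X}) (wd : X -> nat -> option nat).
Hypothesis Agood : forall T, T \in A -> good (wd T).
Hypothesis Ainj : forall T1 T2, T1 \in A -> T2 \in A ->
  {in gtn n, wd T1 =1 wd T2} -> T1 = T2.
Hypothesis Asurj : forall w, good w -> exists2 T, T \in A & {in gtn n, wd T =1 w}.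

Section Breaks.
Variable B : pred nat.

Definition link i := adj i && ~~ B i.

Definition inner i := [&& 0 < i, link i.-1 & link i].

Definition hybrid_ok p (w : nat -> option nat) i := inner i ==>
  if i < p then ~~ (rise w i.-1 && ~~ rise w i) else ~~ (~~ rise w i.-1 && rise w i).

(** The blocks before column [p] have been exchanged, the others not yet. *)
Definition hybrid p := [set T in A | all (hybrid_ok p (wd T)) (iota 0 n)].

Lemma link_lt i : link i -> i.+1 < n.
Proof. by case/andP => /and4P[]. Qed.

Lemma hybridP p T : reflect (T \in A /\ forall i, hybrid_ok p (wd T) i) (T \in hybrid p).
Proof.
rewrite inE; apply: (iffP andP) => [[TA /allP a]|[TA a]]; split=> //; last first.
  by apply/allP => i _.
move=> i; case: (ltnP i n) => ni; first by apply: a; rewrite mem_iota.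
by apply/implyP => /and3P[_ _ /link_lt]; rewrite ltnNge (leq_trans ni).
Qed.

Lemma rise_ext w w' i : {in gtn n, w =1 w'} -> i.+1 < n -> rise w i = rise w' i.
Proof. by move=> ww ni; rewrite /rise !ww // inE ltnW. Qed.

Section Step.
Variables p q : nat.
Hypotheses (pq : p.+1 < q) (qn : q <= n).
Hypothesis bp : (p == 0) || ~~ link p.-1.
Hypothesis bq : ~~ link q.-1.
Hypothesis lpq : forall i, p <= i -> i.+1 < q -> link i.

Lemma step_hS i : p <= i < q -> h i = h p /\ S i.
Proof.
elim: i => [|i IH].
  rewrite leqn0 => /andP[/eqP p0 _]; rewrite p0; split=> //.
  by have /andP[/and4P[_ _ s _] _] := lpq (leqnn p) pq; rewrite -p0.
case/andP => pi iq; move: pi; rewrite leq_eqVlt => /predU1P[<-|pi].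
  by split=> //; have /andP[/and4P[]] := lpq (leqnn p) pq.
have [|hi _] := IH; first by lia.
by have /andP[/and4P[_ /eqP <- _ ->] _] := lpq (i := i) ltac:(lia) ltac:(lia).
Qed.

Lemma inner_cases i : inner i ->
  [\/ i.+1 < p, (p < i) && (i.+1 < q) | q < i].
Proof.
case/and3P=> i0 l1 l2.
have lp : 0 < p -> ~~ link p.-1 by move: bp; case: (p).
have ne1 : i != p.
  by apply/eqP => e; rewrite e in i0 l1; rewrite (negPf (lp i0)) in l1.
have ne2 : i.+1 != p.
  by apply/eqP => e; move: lp; rewrite -e /= l2 => /(_ isT).
have ne3 : i != q by apply: contraL l1 => /eqP->.
have ne4 : i.+1 != q by apply/eqP => e; move: bq; rewrite -e /= l2.
case: (ltnP i.+1 p) => [|pi]; first by constructor 1.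
case: (ltnP q i) => [|iq]; first by constructor 3.
by constructor 2; lia.
Qed.

Definition blk T T' := brel n p q (wd T) (wd T').

Lemma blk_rise w w' i : brel n p q w w' -> inner i -> ~~ ((p < i) && (i.+1 < q)) ->
  rise w' i.-1 = rise w i.-1 /\ rise w' i = rise w i.
Proof.
move=> [_ out] ini mid; have /and3P[i0 _ /link_lt ni] := ini.
have := inner_cases ini; rewrite (negPf mid) => c.
have {}c : i.+1 < p \/ q < i by case: c; [left| |right].
by rewrite /rise prednK // !out //; case: c; lia.
Qed.

Lemma brel_ext w w' w'' : {in gtn n, w' =1 w''} -> brel n p q w w'' -> brel n p q w w'.
Proof.
move=> ww [e out]; split; last by move=> i ni ipq; rewrite ww ?out.
suff -> : seg w' p q = seg w'' p q by [].
apply/eq_in_map => i; rewrite mem_iota => ipq; rewrite ww // inE; lia.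
Qed.

Lemma brel_ext_l w w' w'' : {in gtn n, w' =1 w''} -> brel n p q w'' w -> brel n p q w' w.
Proof.
move=> ww [e out]; split; last by move=> i ni ipq; rewrite ww ?out.
suff -> : seg w' p q = seg w'' p q by [].
apply/eq_in_map => i; rewrite mem_iota => ipq; rewrite ww // inE; lia.
Qed.

Lemma hybrid_step : #|hybrid p| = #|hybrid q|.
Proof.
have pq' : p < q by lia.
have hpq i : p <= i < q -> h i = h p by move=> /step_hS[].
have Spq i : p <= i < q -> S i by move=> /step_hS[].
have inn i : p <= i -> i.+2 < q -> inner i.+1.
  by move=> pi iq; rewrite /inner /= !lpq //; lia.
apply/eqP; rewrite eqn_leq; apply/andP; split.
- apply: (@leq_card_rel _ _ _ blk) => [T /hybridP[TA okT]|T1 T2 T]; last first.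
    move=> /hybridP[A1 _] /hybridP[A2 _] b1 b2; apply: Ainj => //.
    exact: (brel_injl pq' qn Spq (Agood A1) (Agood A2) b1 b2).
  have [|w' [g' b' nov]] := exch_forward hsym hle pq' qn hpq Spq (Agood TA).
    move=> i pi iq; have := okT i.+1; rewrite /hybrid_ok inn //= ltnNge.
    by rewrite (leq_trans pi) ?leqW.
  have [T' T'A e] := Asurj g'; exists T'; last exact: brel_ext b'.
  apply/hybridP; split=> // i; apply/implyP => ini.
  have /and3P[i0 _ /link_lt ni] := ini.
  rewrite !(rise_ext e) //; last by rewrite prednK // ltnW.
  case: (boolP ((p < i) && (i.+1 < q))) => [mid|mid].
    rewrite (_ : i < q); last by lia.
    by have := nov i.-1; rewrite prednK //; apply; lia.
  have [-> ->] := blk_rise b' ini mid; have := okT i; rewrite /hybrid_ok ini /=.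
  by case: (inner_cases ini) mid => [c _|->//|c _];
     [rewrite !ifT|rewrite !ifF]; lia.
- apply: (@leq_card_rel _ _ _ (fun T T' => blk T' T)) =>
    [T /hybridP[TA okT]|T1 T2 T]; last first.
    move=> /hybridP[A1 _] /hybridP[A2 _] b1 b2; apply: Ainj => //.
    exact: (brel_injr pq' qn Spq (Agood A1) (Agood A2) b1 b2).
  have [|w' [g' b' nov]] := exch_backward hsym hle pq' qn hpq Spq (Agood TA).
    move=> i pi iq; have := okT i.+1; rewrite /hybrid_ok inn //= ifT //; lia.
  have [T' T'A e] := Asurj g'; exists T'; last exact: brel_ext_l b'.
  apply/hybridP; split=> // i; apply/implyP => ini.
  have /and3P[i0 _ /link_lt ni] := ini.
  rewrite !(rise_ext e) //; last by rewrite prednK // ltnW.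
  case: (boolP ((p < i) && (i.+1 < q))) => [mid|mid].
    rewrite (_ : (i < p) = false); last by lia.
    by have := nov i.-1; rewrite prednK //; apply; lia.
  have [<- <-] := blk_rise b' ini mid; have := okT i; rewrite /hybrid_ok ini /=.
  by case: (inner_cases ini) mid => [c _|->//|c _];
     [rewrite !ifT|rewrite !ifF]; lia.
Qed.

End Step.

Lemma hybrid_all q : q <= n -> (q == 0) || ~~ link q.-1 -> #|hybrid 0| = #|hybrid q|.
Proof.
have [m] := ubnP q; elim: m q => // m IH q qm qn bq.
case: (posnP q) bq => [->//|q0] /= bq.
pose P p := (p < q) && all link (iota p (q.-1 - p)).
have exP : exists p, P p by exists q.-1; rewrite /P subnn /=; lia.
case: (ex_minnP exP) => p /andP[pq /allP lp] pmin.
have lpq i : p <= i -> i.+1 < q -> link i by move=> pi iq; apply: lp; rewrite mem_iota; lia.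
have bp : (p == 0) || ~~ link p.-1.
  case: (posnP p) => //= p0; apply/negP => l; have /pmin : P p.-1; last by lia.
  rewrite /P (leq_ltn_trans (leq_pred p) pq); apply/allP => i.
  rewrite mem_iota => ipq; case: (eqVneq i p.-1) => [->//|ne].
  by apply: lpq; lia.
have [_ {}bp'] : p < m /\ p <= n by lia.
rewrite (IH p) //; last by lia.
case: (ltnP p.+1 q) => pq'; first exact: hybrid_step.
have {pq'}eq : q = p.+1 by lia.
have E i w : hybrid_ok q w i = hybrid_ok p w i.
  rewrite /hybrid_ok; case: (boolP (inner i)) => //= /and3P[i0 l _].
  have ne : i != p.
    apply/eqP => ip; rewrite ip in i0 l; case/orP: bp => [/eqP p0|/negP//].
    by rewrite p0 in i0.
  by rewrite (_ : (i < q) = (i < p)) //; lia.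
apply: eq_card => T.
by apply/hybridP/hybridP => -[TA okT]; split=> // i; rewrite ?E // -E.
Qed.

Lemma hybrid0n : #|hybrid 0| = #|hybrid n|.
Proof.
apply: hybrid_all => //; case: (posnP n) => //= n0.
by apply/negP => /link_lt; rewrite prednK // ltnn.
Qed.

End Breaks.

Definition peak_set w := [set i : 'I_n | peak_at w i].
Definition valley_set w := [set i : 'I_n | valley_at w i].

Lemma hybrid_cov (B : {set 'I_n}) (b := fun i : nat => [exists j in B, val j == i]) :
  hybrid b 0 = [set T in A | peak_set (wd T) \subset covered B] /\
  hybrid b n = [set T in A | valley_set (wd T) \subset covered B].
Proof.
have bE (i : 'I_n) : b i = (i \in B).
  apply/existsP/idP => [[j /andP[jB /eqP/val_inj<-]]//|iB].
  by exists i; rewrite iB eqxx.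
have covE (i : 'I_n) : 0 < i -> (i \in covered B) = b i || b i.-1.
  move=> i0; rewrite inE bE; congr (_ || _); apply: eq_existsb => j.
  by congr (_ && _); apply/eqP/eqP => /=; lia.
split; apply/setP => T; apply/hybridP/idP => [[TA okT]|].
- rewrite inE TA; apply/subsetP => i; rewrite inE => /and5P[i0 a1 a2 d1 d2].
  rewrite covE //; apply: contraTT isT => /norP[b1 b2].
  by have := okT i; rewrite /hybrid_ok /inner /link i0 a1 a2 b1 b2 d1 d2.
- rewrite inE => /andP[TA /subsetP sub]; split=> // i; apply/implyP.
  case/and3P => i0 /andP[a1 b1] /andP[a2 b2]; apply/negP => /andP[d1 d2].
  have ni : i < n by case/and4P: a2 => /ltnW.
  have := sub (Ordinal ni); rewrite inE /peak_at /= i0 a1 a2 d1 d2 => /(_ isT).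
  by rewrite covE //= (negPf b1) (negPf b2).
- rewrite inE TA; apply/subsetP => i; rewrite inE => /and5P[i0 a1 a2 d1 d2].
  rewrite covE //; apply: contraTT isT => /norP[b1 b2].
  by have := okT i; rewrite /hybrid_ok /inner /link i0 a1 a2 b1 b2 d1 d2 ltn_ord.
- rewrite inE => /andP[TA /subsetP sub]; split=> // i; apply/implyP.
  case/and3P => i0 /andP[a1 b1] /andP[a2 b2].
  have ni : i < n by case/and4P: a2 => /ltnW.
  rewrite ni; apply/negP => /andP[d1 d2].
  have := sub (Ordinal ni); rewrite inE /valley_at /= i0 a1 a2 d1 d2 => /(_ isT).
  by rewrite covE //= (negPf b1) (negPf b2).
Qed.

Lemma peak_valley P :
  #|[set T in A | peak_set (wd T) == P]| = #|[set T in A | valley_set (wd T) == P]|.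
Proof.
apply: triangular => [T _ i j|T _ i j|B].
- rewrite !inE => /and5P[_ _ _ _ d] /and5P[_ _ _ d' _].
  by apply/eqP => e; rewrite e /= d in d'.
- rewrite !inE => /and5P[_ _ _ _ d] /and5P[_ _ _ d' _].
  by apply/eqP => e; rewrite e /= (negPf d) in d'.
by have [<- <-] := hybrid_cov B; apply: hybrid0n.
Qed.

End Equi.

(** * Increasing against decreasing chains *)

Section Core.
Variables (h : nat -> nat) (n K : nat).
Hypothesis hsym : forall i j, (j < h i) = (i < h j).
Hypothesis hle : forall i, h i <= n.
Variable t0 : nat -> nat.
Hypothesis t0K : involutive t0.

(** The involutions that agree with [t0] off the shape; [X] stands for any finite
    set of objects in bijection with them. *)
Definition in_class t := [/\ involutive t, forall x, (t x < h x) = (t0 x < h x)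
  & forall x, ~~ (t0 x < h x) -> t x = t0 x].

Variables (X : finType) (A : {set X}) (tt : X -> nat -> nat).
Hypothesis Aclass : forall T, T \in A -> in_class (tt T).
Hypothesis Ainj : forall T1 T2, T1 \in A -> T2 \in A -> tt T1 =1 tt T2 -> T1 = T2.
Hypothesis Asurj : forall t, in_class t -> exists2 T, T \in A & tt T =1 t.

Definition inside : pred nat := fun x => t0 x < h x.

Definition bounded (w : nat -> option nat) :=
  all (fun x => if w x is Some r then r < K else true) (iota 0 n).

Lemma boundedP w : reflect (forall x r, x < n -> w x = Some r -> r < K) (bounded w).
Proof.
apply: (iffP allP) => [b x r xn wx|b x].
  by have := b x; rewrite mem_iota wx; apply.
by rewrite mem_iota; case wx : (w x) => [r|//] /= xn; apply: b wx.
Qed.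

Definition wd T := bword h (tt T).

Definition avoid_decr := [set T in A | bounded (wd T)].
Definition avoid_incr := [set T in A | bounded (trw h n (wd T))].

Lemma wd_valid T : T \in A -> valid h n (wd T).
Proof. by move=> /Aclass[tK _ _]; apply: word_valid. Qed.

Lemma wd_None T x : T \in A -> (wd T x != None) = inside x.
Proof. by move=> /Aclass[tK tS _]; rewrite word_None negbK tS. Qed.

Lemma wd_inj T1 T2 : T1 \in A -> T2 \in A -> {in gtn n, wd T1 =1 wd T2} -> T1 = T2.
Proof.
move=> A1 A2 ww; apply: Ainj => // x.
have [K1 S1 N1] := Aclass A1; have [K2 S2 N2] := Aclass A2.
case: (boolP (t0 x < h x)) => xS; last by rewrite N1 ?N2.
by symmetry; apply: (word_inj hsym hle K1 K2 ww); rewrite S1.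
Qed.

Lemma wd_surj w : valid h n w -> (forall x, x < n -> (w x != None) = inside x) ->
  exists2 T, T \in A & {in gtn n, wd T =1 w}.
Proof.
move=> v wN; have [|t [tK tS tN tw]] := word_surj hsym hle v t0K.
  by move=> x xn; rewrite -[_ == _]negbK wN.
have [|T TA e] := Asurj (t := t); first by split.
exists T => // x xn; rewrite /wd -tw //.
have grow_ext m x' y' : grow h (tt T) m x' y' = grow h t m x' y'.
  elim: m x' y' => [|m IH] x' [|y'] //=; by rewrite /dot e !IH.
by rewrite /bword /edge grow_ext.
Qed.

Local Notation good := (good h n K inside).
Local Notation adj := (adj h n inside).

Lemma avoid_decr_good T : T \in avoid_decr -> good (wd T).
Proof.
rewrite inE => /andP[TA /boundedP b]; split=> //; first exact: wd_valid.
by move=> x _; apply: wd_None.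
Qed.

Lemma avoid_decr_surj w : good w -> exists2 T, T \in avoid_decr & {in gtn n, wd T =1 w}.
Proof.
case=> v wN wK; have [T TA e] := wd_surj v wN; exists T => //.
by rewrite inE TA; apply/boundedP => x r xn; rewrite e //; apply: wK.
Qed.

Lemma trw_ext w w' : {in gtn n, w =1 w'} -> {in gtn n, trw h n w =1 trw h n w'}.
Proof.
move=> ww x xn; rewrite /trw ww //; case: (w' x) => // r; congr Some.
have c y s : y <= n -> cnt w y s = cnt w' y s.
  by move=> yn; apply: eq_cnt => i iy; apply: ww; rewrite inE (leq_trans _ yn).
by rewrite /wpart !c // ltnW.
Qed.

Lemma valley_at_trw w w' x : valid h n w -> (forall x, x < n -> (w x != None) = inside x) ->
  {in gtn n, w' =1 trw h n w} -> valley_at h n inside w' x = peak_at h n inside w x.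
Proof.
move=> v wN ww.
have D i : adj i -> rise w' i = ~~ rise w i.
  case/and4P => ni /eqP hi Si Si1; have ni' := ltnW ni.
  rewrite /rise !ww ?inE //.
  have := wN _ ni; have := wN _ ni'; rewrite Si Si1.
  case wi : (w i) => [a|] // _; case wi1 : (w i.+1) => [b|] // _.
  have e : trw h n w i = Some (wpart n w i (h i) a) by rewrite /trw wi.
  have e1 : trw h n w i.+1 = Some (wpart n w i.+1 (h i.+1) b) by rewrite /trw wi1.
  by rewrite e e1 /= (trw_desc hsym hle v ni hi wi wi1 e e1) -ltnNge.
rewrite /valley_at /peak_at; case: (posnP x) => //= x0.
case a1 : (adj x.-1) => //=; case a2 : (adj x) => //=.
by rewrite !D // negbK.
Qed.

(** Transposing the partitions along the boundary exchanges rows and columns, hence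
    increasing and decreasing chains, and it turns rises into non-rises. *)
Lemma transpose_card P :
  #|[set T in avoid_incr | peak_set h n inside (wd T) == P]| =
  #|[set T in avoid_decr | valley_set h n inside (wd T) == P]|.
Proof.
pose R T T' := {in gtn n, wd T' =1 trw h n (wd T)}.
have KT T : T \in A -> {in gtn n, trw h n (trw h n (wd T)) =1 wd T}.
  by move=> TA x xn; apply: (trwK hsym hle (wd_valid TA)).
have Rsym T T' : T \in A -> R T T' -> R T' T.
  by move=> TA r x xn; rewrite (trw_ext r) ?KT.
have Rinj T1 T2 T : T1 \in A -> T2 \in A -> R T1 T -> R T2 T -> T1 = T2.
  move=> A1 A2 r1 r2; apply: wd_inj => // x xn.
  by rewrite (Rsym _ _ A1 r1) // (Rsym _ _ A2 r2).
have ext (w w' : nat -> option nat) : {in gtn n, w =1 w'} -> bounded w -> bounded w'.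
  move=> e /boundedP b; apply/boundedP => x r xn; rewrite -e //; exact: b.
have ex T : T \in A -> exists2 T', T' \in A & R T T'.
  move=> TA; apply: wd_surj; first exact: (trw_valid hsym hle (wd_valid TA)).
  by move=> x xn; rewrite trw_None wd_None.
have PV T T' : T \in A -> R T T' ->
    valley_set h n inside (wd T') = peak_set h n inside (wd T).
  move=> TA r; apply/setP => i; rewrite !inE; apply: valley_at_trw => //.
    exact: wd_valid.
  by move=> x _; apply: wd_None.
apply/eqP; rewrite eqn_leq; apply/andP; split.
  apply: (@leq_card_rel _ _ _ R) => [T|T1 T2 T]; rewrite !inE -!andbA; last first.
    by move=> /and3P[A1 _ _] /and3P[A2 _ _]; apply: Rinj.
  case/and3P => TA b /eqP<-; have [T' T'A r] := ex T TA; exists T' => //.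
  by rewrite !inE T'A (PV T) // eqxx andbT; apply: ext b => x xn; rewrite r.
apply: (@leq_card_rel _ _ _ R) => [T|T1 T2 T]; rewrite !inE -!andbA; last first.
  by move=> /and3P[A1 _ _] /and3P[A2 _ _]; apply: Rinj.
case/and3P => TA b /eqP<-; have [T' T'A r] := ex T TA; exists T' => //.
have r' := Rsym _ _ TA r.
by rewrite !inE T'A -(PV T' T) // eqxx andbT; apply: ext b.
Qed.

Definition tpeak (t : nat -> nat) i :=
  [&& 0 < i, adj i.-1, adj i, t i.-1 < t i & t i.+1 < t i].

Lemma tpeak_word T i : T \in A -> tpeak (tt T) i = peak_at h n inside (wd T) i.
Proof.
move=> TA; have [tK tS _] := Aclass TA.
have D j : adj j -> (tt T j.+1 < tt T j) = rise (wd T) j.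
  case/and4P => nj /eqP hj Sj Sj1.
  have := wd_None j TA; have := wd_None j.+1 TA; rewrite Sj Sj1 /rise.
  case wj1 : (wd T j.+1) => [b|] // _; case wj : (wd T j) => [a|] // _.
  exact: (word_desc hsym tK hj wj wj1).
rewrite /tpeak /peak_at; case: (posnP i) => //= i0.
case a1 : (adj i.-1) => //=; case a2 : (adj i) => //=.
rewrite -!D // prednK // -leqNgt [X in _ = X && _]leq_eqVlt.
case: eqP => //= /(can_inj tK) e; have := ltn_predL i; rewrite e; lia.
Qed.

Definition tpeak_set (t : nat -> nat) := [set i : 'I_n | tpeak t i].

Lemma core_card P :
  #|[set T in avoid_incr | tpeak_set (tt T) == P]| =
  #|[set T in avoid_decr | tpeak_set (tt T) == P]|.
Proof.
have CPE T : T \in A -> tpeak_set (tt T) = peak_set h n inside (wd T).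
  by move=> TA; apply/setP => i; rewrite !inE tpeak_word.
have decrE e : [set T in avoid_decr | e (tpeak_set (tt T))] =
    [set T in avoid_decr | e (peak_set h n inside (wd T))].
  by apply/setP => T; rewrite !inE -!andbA; case: (boolP (T \in A)) => //= /CPE->.
have incrE e : [set T in avoid_incr | e (tpeak_set (tt T))] =
    [set T in avoid_incr | e (peak_set h n inside (wd T))].
  by apply/setP => T; rewrite !inE -!andbA; case: (boolP (T \in A)) => //= /CPE->.
rewrite (decrE (eq_op^~ P)) (incrE (eq_op^~ P)) transpose_card.
symmetry; apply: (@peak_valley h n K inside) => //.
- exact: avoid_decr_good.
- move=> T1 T2; rewrite !inE => /andP[A1 _] /andP[A2 _]; exact: wd_inj.
- exact: avoid_decr_surj.
Qed.

Lemma avoid_decrP T : T \in A -> reflect (~ dec_occ h (tt T) K.+1) (T \in avoid_decr).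
Proof.
move=> TA; have [tK tS _] := Aclass TA; rewrite inE TA.
apply: (iffP (boundedP _)) => [b /(dec_occP hsym tK)[x [r [wx]]]|no x r xn wx].
  rewrite leqNgt (b x r) // ltnNge; apply/negP => nx.
  have := wd_None x TA; rewrite /wd wx /inside -tS (shape_out hsym hle) //.
by rewrite ltnNge; apply/negP => Kr; apply/no/(dec_occP hsym tK); exists x, r.
Qed.

Lemma avoid_incrP T : T \in A -> reflect (~ inc_occ h (tt T) K.+1) (T \in avoid_incr).
Proof.
move=> TA; have [tK tS _] := Aclass TA; rewrite inE TA.
apply: (iffP (boundedP _)) => [b /(inc_occP hsym tK)[x [r [wx]]]|no x r xn wx].
  have xn : x < n.
    rewrite ltnNge; apply/negP => nx; have := wd_None x TA.
    rewrite /inside -tS (shape_out hsym hle) //.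
    by move: wx; rewrite /tword /wd; case: (bword _ _ x).
  by rewrite leqNgt (b x r) // -(trw_word hsym hle tK).
rewrite ltnNge; apply/negP => Kr; apply/no/(inc_occP hsym tK); exists x, r.
by rewrite (trw_word hsym hle tK).
Qed.

End Core.

(** * Diagrams and their symmetric transversals *)

Section Diagram.
Variable la : seq nat.
Hypotheses (hla : is_partition la) (hsc : self_conjugate la).

Local Notation n := (ncols la).

Definition height i := nth 0 la i.

Lemma nrows_ncols : nrows la = n.
Proof. by rewrite -{1}(eqP hsc) /nrows size_mkseq. Qed.

Lemma la_sorted : sorted geq la. Proof. by case/andP: hla. Qed.

Lemma height_anti i j : i <= j -> height j <= height i.
Proof.
move=> ij; rewrite /height; case: (ltnP j (size la)) => jl; last by rewrite nth_default.
have := @sorted_leq_nth _ _ geq_trans _ 0 _ la_sorted i j.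
by rewrite !inE; apply => //; [move=> x; rewrite /geq /=|apply: leq_ltn_trans jl].
Qed.

Lemma height_le i : height i <= n.
Proof. by apply: leq_trans (height_anti (leq0n i)) _; rewrite /height nth0. Qed.

Lemma height_out i : n <= i -> height i = 0.
Proof. by move=> ni; rewrite /height nth_default // -[size la]/(nrows la) nrows_ncols. Qed.

Lemma col_lenE i j : (j < col_len la i) = (i < height j).
Proof.
rewrite /col_len /height; have := la_sorted; elim: la j => [|x s IH] j.
  by rewrite nth_nil.
move=> /= xs; have ss := path_sorted xs; case: j => [|j] /=; last first.
  case: (ltnP i x) => ix; first by rewrite add1n ltnS IH.
  rewrite add0n; have /allP xa := order_path_min geq_trans xs.
  have -> : (i < nth 0 s j) = false.
    case: (ltnP j (size s)) => js; last by rewrite nth_default.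
    by have := xa _ (mem_nth 0 js); rewrite /geq /=; lia.
  rewrite (_ : count _ s = 0) //; apply/eqP; rewrite -leqn0 leqNgt -has_count.
  by apply/hasPn => y /xa; rewrite /geq /=; lia.
case: (ltnP i x) => //= ix; rewrite add0n; apply/negbTE; rewrite -leqNgt leqn0.
rewrite -leqn0 leqNgt -has_count; apply/hasPn => y.
by have /allP xa := order_path_min geq_trans xs; move/xa; rewrite /geq /=; lia.
Qed.

Lemma col_len_height i : i < n -> col_len la i = height i.
Proof. by move=> ni; rewrite /height -[in RHS](eqP hsc) nth_mkseq. Qed.

Lemma height_sym i j : (j < height i) = (i < height j).
Proof.
case: (ltnP i n) => ni; first by rewrite -col_len_height // col_lenE.
by rewrite height_out // ltn0; apply/esym/negbTE; rewrite -leqNgt (leq_trans (height_le j)).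
Qed.

Lemma in_shapeE i j : in_shape la i j = (j < height i).
Proof. by rewrite height_sym. Qed.

(** The identity outside of the diagram makes this an involution of [nat]. *)
Definition tval (T : filling la) (i : nat) : nat :=
  if insub i is Some i' then Defs.word T i' else i.

Lemma tval_ord (T : filling la) (i : 'I_n) : tval T i = Defs.word T i.
Proof. by rewrite /tval valK. Qed.

Lemma tval_out (T : filling la) i : n <= i -> tval T i = i.
Proof. by move=> ni; rewrite /tval insubF // ltnNge ni. Qed.

Lemma memT (T : filling la) (i : 'I_n) (j : 'I_(nrows la)) : T \in ST la ->
  ((i, j) \in T) = (tval T i == j).
Proof.
rewrite inE => /andP[/and3P[_ /forallP/(_ i)/cards1P[j0 e] _] _].
have m j' : ((i, j') \in T) = (j' == j0) by move/setP/(_ j'): e; rewrite !inE.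
rewrite tval_ord /Defs.word; case: pickP => [j'|/(_ j0)]; rewrite m ?eqxx //.
by move=> /eqP->; rewrite m eq_sym.
Qed.

Lemma tval_lt (T : filling la) i : T \in ST la -> i < n -> tval T i < n.
Proof.
move=> TS ni; rewrite (_ : i = Ordinal ni) // tval_ord /Defs.word.
case: pickP => [j _|]; first by rewrite -[X in _ < X]nrows_ncols.
by move=> _ /=; apply: leq_ltn_trans ni.
Qed.

Lemma tvalK (T : filling la) : T \in ST la -> involutive (tval T).
Proof.
move=> TS i; case: (ltnP i n) => ni; last by rewrite !tval_out.
have ti := tval_lt TS ni.
have tr : tval T i < nrows la by rewrite nrows_ncols.
have ir : i < nrows la by rewrite nrows_ncols.
have := memT (Ordinal ni) (Ordinal tr) TS; rewrite /= eqxx => m.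
have := TS; rewrite inE => /andP[_ /forallP/(_ (Ordinal ni, Ordinal tr))].
move=> /forallP/(_ (Ordinal ti, Ordinal ir)); rewrite /= !eqxx m /=.
by rewrite (memT _ _ TS) /= => /eqP/esym/eqP.
Qed.

Lemma tval_height (T : filling la) i : T \in ST la -> i < n -> tval T i < height i.
Proof.
move=> TS ni; have tr : tval T i < nrows la by rewrite nrows_ncols tval_lt.
have := memT (Ordinal ni) (Ordinal tr) TS; rewrite /= eqxx => m.
have := TS; rewrite inE => /andP[/and3P[/forallP/(_ (Ordinal ni, Ordinal tr)) + _ _] _].
by rewrite m /= in_shapeE.
Qed.

Lemma tval_inj (T1 T2 : filling la) : T1 \in ST la -> T2 \in ST la ->
  tval T1 =1 tval T2 -> T1 = T2.
Proof.
by move=> S1 S2 e; apply/setP => -[i j]; rewrite !memT // e.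
Qed.

Lemma tval_surj t : involutive t -> (forall i, i < n -> t i < height i) ->
  (forall i, n <= i -> t i = i) -> exists2 T, T \in ST la & tval T =1 t.
Proof.
move=> tK th tout; pose T : filling la :=
  [set p : 'I_n * 'I_(nrows la) | t p.1 == p.2 :> nat].
have tr i : i < n -> t i < nrows la.
  by move=> ni; rewrite nrows_ncols (leq_trans (th i ni)) ?height_le.
have tn i : i < n -> t i < n by move=> ni; rewrite -nrows_ncols tr.
have TS : T \in ST la.
  rewrite inE; apply/andP; split; [apply/and3P; split|].
  - apply/forallP => -[i j]; rewrite inE /=; apply/implyP => /eqP <-.
    by rewrite in_shapeE th.
  - apply/forallP => i; apply/cards1P; exists (Ordinal (tr i (ltn_ord i))).
    by apply/setP => j; rewrite !inE -val_eqE eq_sym.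
  - apply/forallP => j; have jn : j < n by rewrite -nrows_ncols.
    apply/cards1P; exists (Ordinal (tn j jn)).
    by apply/setP => i; rewrite !inE -val_eqE /= (can2_eq tK tK).
  - apply/forallP => -[i j]; apply/forallP => -[i' j'] /=.
    apply/implyP => /andP[/eqP e1 /eqP e2]; rewrite !inE /= e1 -e2.
    by rewrite (can2_eq tK tK) [X in X == _]eq_sym.
exists T => // i; case: (ltnP i n) => ni; last by rewrite tval_out ?tout.
have := memT (Ordinal ni) (Ordinal (tr i ni)) TS; rewrite inE /= eqxx.
by move/esym/eqP.
Qed.

Lemma PeakE (T : filling la) (i : 'I_n) : (i \in Peak T) =
  [&& 0 < i, i.+1 < n, height i.-1 == height i, height i == height i.+1,
      tval T i.-1 < tval T i & tval T i.+1 < tval T i].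
Proof.
rewrite inE; apply/existsP/and5P => [[g /existsP[j]]|[i0 ni h1 h2]].
  case/and5P=> /eqP ei /eqP ej; rewrite !col_len_height // -!tval_ord.
  move=> h1 h2 /andP[t1 t2]; have eg : i.-1 = g by rewrite ei.
  have i0 : 0 < i by rewrite ei.
  by rewrite eg -ej h1 h2 t1 t2 ltn_ord i0.
case/andP => t1 t2; have pi : i.-1 < n by apply: leq_ltn_trans (leq_pred i) _.
exists (Ordinal pi); apply/existsP; exists (Ordinal ni).
rewrite !col_len_height // -!tval_ord /= prednK // !eqxx h1 h2 t1 t2.
by [].
Qed.

(** * The region dominated by a pattern *)

Definition pat (h t : nat -> nat) m (s : 'S_m) (c r : 'I_m -> nat) :=
  [/\ forall x y : 'I_m, x < y -> c x < c y, forall x y : 'I_m, x < y -> r x < r y,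
      forall x y, r y < h (c x) & forall x, t (c x) = r (s x)].

Lemma incr_inj m (c : 'I_m -> nat) : (forall x y : 'I_m, x < y -> c x < c y) -> injective c.
Proof.
move=> ci x y e; apply/val_inj; case: (ltngtP x y) => // xy.
  by have := ci _ _ xy; rewrite e ltnn.
by have := ci _ _ xy; rewrite e ltnn.
Qed.

Lemma incr_le m (c : 'I_m -> nat) : (forall x y : 'I_m, x < y -> c x < c y) ->
  forall x y : 'I_m, x <= y -> c x <= c y.
Proof.
move=> ci x y; rewrite leq_eqVlt => /predU1P[/val_inj->//|/ci].
exact: ltnW.
Qed.

Definition patb (T : filling la) m (s : 'S_m)
    (c : {ffun 'I_m -> 'I_n}) (r : {ffun 'I_m -> 'I_(nrows la)}) :=
  [&& [forall x : 'I_m, forall y : 'I_m, (x < y) ==> (c x < c y)],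
      [forall x : 'I_m, forall y : 'I_m, (x < y) ==> (r x < r y)],
      [forall x : 'I_m, forall y : 'I_m, in_shape la (c x) (r y)] &
      [forall x : 'I_m, forall y : 'I_m, ((c x, r y) \in T) == (y == s x)]].

Lemma patbP (T : filling la) m (s : 'S_m) (c : {ffun 'I_m -> 'I_n})
    (r : {ffun 'I_m -> 'I_(nrows la)}) : T \in ST la ->
  reflect (pat height (tval T) s (fun x => c x) (fun x => r x)) (patb T s c r).
Proof.
move=> TS; apply: (iffP and4P) => [[/forallP p1 /forallP p2 /forallP p3 /forallP p4]|].
  split=> [x y xy|x y xy|x y|x].
  - by have /forallP/(_ y)/implyP := p1 x; apply.
  - by have /forallP/(_ y)/implyP := p2 x; apply.
  - by have /forallP/(_ y) := p3 x; rewrite in_shapeE.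
  - have /forallP/(_ (s x)) := p4 x; rewrite eqxx memT // eqb_id.
    by move/eqP.
case=> p1 p2 p3 p4; split; apply/forallP => x; apply/forallP => y.
- by apply/implyP; apply: p1.
- by apply/implyP; apply: p2.
- by rewrite in_shapeE.
- rewrite memT // p4; apply/eqP.
  exact: etrans (inj_eq (incr_inj p2) _ _) (eq_sym _ _).
Qed.

Lemma pat_lift t m (s : 'S_m) c r : pat height t s c r ->
  exists (c' : {ffun 'I_m -> 'I_n}) (r' : {ffun 'I_m -> 'I_(nrows la)}),
  (forall x, c' x = c x :> nat) /\ (forall x, r' x = r x :> nat).
Proof.
case=> _ _ p3 _.
have rl y : r y < nrows la.
  by rewrite nrows_ncols; apply: leq_trans (p3 y y) (height_le _).
have cl x : c x < n.
  by have := p3 x x; rewrite height_sym => /leq_trans; apply; apply: height_le.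
exists [ffun x => Ordinal (cl x)], [ffun x => Ordinal (rl x)].
by split=> x; rewrite ffunE.
Qed.

Lemma eq_pat h t m (s : 'S_m) c c' r r' : c =1 c' -> r =1 r' ->
  pat h t s c r -> pat h t s c' r'.
Proof.
move=> ec er [p1 p2 p3 p4].
by split=> [x y|x y|x y|x]; rewrite -?ec -?er; auto.
Qed.

Lemma containsP (T : filling la) m (s : 'S_m) : T \in ST la ->
  contains T s <-> exists c r, pat height (tval T) s c r.
Proof.
move=> TS; split=> [/existsP[c /existsP[r /(patbP _ _ _ TS) p]]|[c [r p]]].
  by exists (fun x => nat_of_ord (c x)), (fun x => nat_of_ord (r x)).
have [c' [r' [ec er]]] := pat_lift p.
apply/existsP; exists c'; apply/existsP; exists r'; apply/(patbP _ _ _ TS).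
by apply: eq_pat p => x; rewrite ?ec ?er.
Qed.

Section Region.
Variables (b : nat) (tau : 'S_b).

Definition dominated (T : filling la) (i j : nat) :=
  (j < height i) && [exists c, exists r,
    [&& patb T tau c r, [forall x, i < c x] & [forall x, j < r x]]].

Lemma dominatedP (T : filling la) i j : T \in ST la ->
  reflect (j < height i /\ exists c r, [/\ pat height (tval T) tau c r,
    forall x, i < c x & forall x, j < r x]) (dominated T i j).
Proof.
move=> TS; apply: (iffP andP) => -[ji].
  move=> /existsP[c /existsP[r /and3P[/(patbP _ _ _ TS) p /forallP ci /forallP rj]]].
  by split=> //; exists (fun x => nat_of_ord (c x)), (fun x => nat_of_ord (r x)).
case=> c [r [p ci rj]]; split=> //; have [c' [r' [ec er]]] := pat_lift p.
apply/existsP; exists c'; apply/existsP; exists r'; apply/and3P; split.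
- by apply/(patbP _ _ _ TS); apply: eq_pat p => x; rewrite ?ec ?er.
- by apply/forallP => x; rewrite ec.
- by apply/forallP => x; rewrite er.
Qed.

Lemma dominated_le T i j i' j' : T \in ST la -> i' <= i -> j' <= j ->
  dominated T i j -> dominated T i' j'.
Proof.
move=> TS ii jj /(dominatedP _ _ TS)[ji [c [r [p ci rj]]]].
apply/(dominatedP _ _ TS); split.
  by apply: leq_ltn_trans jj _; apply: leq_trans ji (height_anti _).
exists c, r; split=> // x; first exact: leq_ltn_trans (ci x).
exact: leq_ltn_trans (rj x).
Qed.

(** A symmetric transversal has I_k or J_k with corner in a set of squares when it
    has one with corner in the reflected set, so the set may be made symmetric. *)
Definition region T i j := dominated T i j || dominated T j i.

Lemma regionC T i j : region T i j = region T j i.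
Proof. by rewrite /region orbC. Qed.

Lemma region_le T i j i' j' : T \in ST la -> i' <= i -> j' <= j ->
  region T i j -> region T i' j'.
Proof.
move=> TS ii jj /orP[/(dominated_le TS ii jj)|/(dominated_le TS jj ii)];
  by rewrite /region => ->; rewrite ?orbT.
Qed.

Lemma region_height T i j : region T i j -> j < height i.
Proof. by case/orP => /andP[+ _]; rewrite // height_sym. Qed.

Lemma region_lt T i j : region T i j -> i < n /\ j < n.
Proof.
move=> /region_height ji; split; last exact: leq_trans ji (height_le _).
by move: ji; rewrite height_sym => /leq_trans; apply; apply: height_le.
Qed.

Definition rheight T i := find (predC (region T i)) (iota 0 n).

Lemma rheightE T i j : T \in ST la -> (j < rheight T i) = region T i j.
Proof.
move=> TS; apply/idP/idP => [ji|rij].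
  have := before_find 0 ji; rewrite nth_iota; last first.
    by apply: leq_trans ji _; rewrite -[leqRHS](size_iota 0) find_size.
  by move/negbFE.
rewrite ltnNge; apply/negP => le; have [_ jn] := region_lt rij.
have hs : has (predC (region T i)) (iota 0 n).
  by rewrite has_find size_iota; apply: leq_ltn_trans le jn.
have := nth_find 0 hs; rewrite nth_iota /=; last by rewrite -[ltnRHS](size_iota 0) -has_find.
by rewrite add0n (region_le TS (leqnn i) le rij).
Qed.

Lemma rheight_sym T : T \in ST la -> forall i j, (j < rheight T i) = (i < rheight T j).
Proof. by move=> TS i j; rewrite !rheightE // regionC. Qed.

Lemma rheight_le T i : rheight T i <= n.
Proof. by rewrite -[leqRHS](size_iota 0) find_size. Qed.

(** An occurrence of [tau] that dominates a square of column [x] but none of column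
    [x + 1] has to use the latter column, or row in the reflected case. *)
Lemma region_drop T x y : T \in ST la -> height x = height x.+1 ->
  region T x y -> ~~ region T x.+1 y -> y < tval T x.+1.
Proof.
move=> TS hx; rewrite /region negb_or => /orP[] d /andP[n1 n2].
  have /(dominatedP _ _ TS)[yx [c [r [p cx ry]]]] := d.
  case: (boolP [forall z, x.+1 < c z]) => [/forallP cx1|/forallPn[z]].
    by case/(dominatedP _ _ TS): n1; rewrite -hx; split=> //; exists c, r.
  rewrite -leqNgt => cz; have {}cz : c z = x.+1.
    by apply/eqP; rewrite eqn_leq cz cx.
  by have [_ _ _ p4] := p; rewrite -cz p4.
have /(dominatedP _ _ TS)[yx [c [r [p cx ry]]]] := d.
case: (boolP [forall z, x.+1 < r z]) => [/forallP cx1|/forallPn[z]].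
  case/(dominatedP _ _ TS): n2; split; last by exists c, r.
  by rewrite height_sym -hx -height_sym.
rewrite -leqNgt => cz; have {}cz : r z = x.+1.
  by apply/eqP; rewrite eqn_leq cz ry.
have [_ _ _ p4] := p; have := p4 (tau^-1 z)%g; rewrite permKV cz => e.
by rewrite -e (tvalK TS).
Qed.

(** Extremal squares of the region are dominated by 1s outside of the region. *)
Lemma region_max T i j : T \in ST la -> region T i j ->
  exists i' j', [/\ i <= i', j <= j', dominated T i' j' \/ dominated T j' i'
    & forall x y, i' < x -> j' < y -> ~~ region T x y].
Proof.
move=> TS; have [m] := ubnP (n + n - (i + j)); elim: m i j => // m IH i j ijm rij.
have [in_ jn] := region_lt rij.
case: (boolP [exists p : 'I_n * 'I_n, [&& i < p.1, j < p.2 & region T p.1 p.2]]).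
  case/existsP => -[x y] /= /and3P[ix jy rxy].
  have := ltn_ord x; have := ltn_ord y => yn xn.
  have [|i' [j' [xi yj d mx]]] := IH x y _ rxy; first by lia.
  by exists i', j'; split=> //; lia.
rewrite negb_exists => /forallP no; exists i, j; split=> //; first exact/orP.
move=> x y ix jy; apply/negP => rxy; have [xn yn] := region_lt rxy.
by have := no (Ordinal xn, Ordinal yn); rewrite /= ix jy rxy.
Qed.

Lemma dominated_transfer T1 T2 i j : T1 \in ST la -> T2 \in ST la ->
  (forall x, i < x -> j < tval T1 x -> tval T2 x = tval T1 x) ->
  dominated T1 i j -> dominated T2 i j.
Proof.
move=> S1 S2 e /(dominatedP _ _ S1)[ji [c [r [[p1 p2 p3 p4] ci rj]]]].
apply/(dominatedP _ _ S2); split=> //; exists c, r; split=> //; split=> // x.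
by rewrite e ?p4.
Qed.

Section SameClass.
Variables T0 T : filling la.
Hypotheses (S0 : T0 \in ST la) (S1 : T \in ST la).
Hypothesis cl : in_class (rheight T0) (tval T0) (tval T).

Lemma class_off x : ~~ region T0 x (tval T x) -> tval T x = tval T0 x.
Proof.
have [_ tS tN] := cl; rewrite -rheightE // tS => /tN.
by [].
Qed.

Lemma class_off0 x : ~~ region T0 x (tval T0 x) -> tval T x = tval T0 x.
Proof. by have [_ tS tN] := cl; rewrite -rheightE // => /tN. Qed.

(** Extremal squares of either region are dominated by 1s that lie outside of it;
    once the first region is known to be inside the second, such 1s are common to
    both transversals. *)
Lemma class_region i j : region T i j = region T0 i j.
Proof.
have sub i' j' : region T0 i' j' -> region T i' j'.
  move=> r0; have [x [y [ix jy d mx]]] := region_max S0 r0.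
  apply: (region_le S1 ix jy); apply/orP.
  case: d => d; [left|right]; apply: dominated_transfer d => // z z1 z2.
    by apply: class_off0; apply: mx.
  by apply: class_off0; rewrite regionC; apply: mx.
apply/idP/idP => [r1|]; last exact: sub.
have [x [y [ix jy d mx]]] := region_max S1 r1.
apply: (region_le S0 ix jy); apply/orP.
case: d => d; [left|right]; apply: dominated_transfer d => // z z1 z2; symmetry;
  apply: class_off; apply: contra (sub _ _) _; first exact: mx.
by rewrite regionC; apply: mx.
Qed.

End SameClass.

(** * Occurrences of a direct sum *)

Lemma dsum_l k (p : 'S_k) x : dsum p tau (lshift b x) = lshift b (p x).
Proof. by rewrite permE /dsum_fun (unsplitK (inl x)). Qed.

Lemma dsum_r k (p : 'S_k) y : dsum p tau (rshift k y) = rshift k (tau y).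
Proof. by rewrite permE /dsum_fun (unsplitK (inr y)). Qed.

Section Corner.
Variables (T : filling la) (K : nat) (p : 'S_K.+1).
Hypothesis TS : T \in ST la.
Hypothesis pK : forall x, p (p x) = x.

Lemma dominated_dsum (c r : 'I_K.+1 -> nat) :
  (forall x y : 'I_K.+1, x < y -> c x < c y) ->
  (forall x y : 'I_K.+1, x < y -> r x < r y) ->
  (forall x, tval T (c x) = r (p x)) ->
  dominated T (c ord_max) (r ord_max) -> contains T (dsum p tau).
Proof.
move=> ci ri cr /(dominatedP _ _ TS)[rc [c' [r' [[p1 p2 p3 p4] cc rr]]]].
have cm x : c x <= c ord_max by apply: incr_le => //; apply: leq_ord.
have rm x : r x <= r ord_max by apply: incr_le => //; apply: leq_ord.
pose glue (u : 'I_K.+1 -> nat) (v : 'I_b -> nat) (z : 'I_(K.+1 + b)) :=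
  match split z with inl x => u x | inr y => v y end.
have gl u v x : glue u v (lshift b x) = u x by rewrite /glue (unsplitK (inl x)).
have gr u v y : glue u v (rshift _ y) = v y by rewrite /glue (unsplitK (inr y)).
have gi (u : 'I_K.+1 -> nat) v : (forall x y : 'I_K.+1, x < y -> u x < u y) ->
    (forall x y : 'I_b, x < y -> v x < v y) -> (forall x y, u x < v y) ->
    forall x y : 'I_(K.+1 + b), x < y -> glue u v x < glue u v y.
  move=> ui vi uv x y.
  case: (split_ordP x) => x' ->; case: (split_ordP y) => y' ->; rewrite ?gl ?gr //=.
  - exact: ui.
  - by have := ltn_ord y'; lia.
  - by rewrite ltn_add2l; apply: vi.
apply/(containsP _ TS); exists (glue c c'), (glue r r'); split.
- by apply: gi => // x y; apply: leq_ltn_trans (cm x) (cc y).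
- by apply: gi => // x y; apply: leq_ltn_trans (rm x) (rr y).
- move=> x y.
  case: (split_ordP x) => x' ->; case: (split_ordP y) => y' ->; rewrite ?gl ?gr //.
  + apply: leq_ltn_trans (rm _) _; apply: leq_trans rc _; exact: height_anti.
  + apply: leq_trans (p3 y' y') _; apply: height_anti.
    by apply: leq_trans (cm _) (ltnW (cc _)).
  + by apply: leq_ltn_trans (rm _) _; apply: ltn_trans (rr x') (p3 _ _).
- move=> x; case: (split_ordP x) => x' ->; rewrite ?dsum_l ?dsum_r ?gl ?gr //.
Qed.

(** If the corner is dominated only after reflection, the reflected occurrence of
    the involution [p] is again one of [p]. *)
Lemma contains_dsum : contains T (dsum p tau) <-> exists c r : 'I_K.+1 -> nat,
  [/\ forall x y : 'I_K.+1, x < y -> c x < c y,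
      forall x y : 'I_K.+1, x < y -> r x < r y,
      forall x, tval T (c x) = r (p x) & region T (c ord_max) (r ord_max)].
Proof.
split=> [/(containsP _ TS)[c [r [p1 p2 p3 p4]]]|[c [r [ci ri cr]]]].
  exists (c \o lshift b), (r \o lshift b); split=> /= [x y xy|x y xy|x|].
  - exact: p1.
  - exact: p2.
  - by rewrite p4 dsum_l.
  apply/orP; left; apply/(dominatedP _ _ TS); split; first exact: p3.
  exists (c \o @rshift K.+1 b), (r \o @rshift K.+1 b); split=> [|x|x] /=; last 2 first.
  - by apply: p1; rewrite /= ltn_addr.
  - by apply: p2; rewrite /= ltn_addr.
  split=> /= [x y xy|x y xy|x y|x].
  - by apply: p1; rewrite /= ltn_add2l.
  - by apply: p2; rewrite /= ltn_add2l.
  - exact: p3.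
  - by rewrite p4 dsum_r.
case/orP; first exact: dominated_dsum.
apply: dominated_dsum => // x.
by rewrite -[x in r x]pK -cr tvalK.
Qed.

End Corner.

Lemma sorted_incr (s : seq nat) K : size s = K.+1 -> sorted ltn s ->
  forall x y : 'I_K.+1, x < y -> nth 0 s x < nth 0 s y.
Proof.
move=> sz ss x y xy.
by apply: (sorted_ltn_nth ltn_trans 0 ss); rewrite ?inE ?sz.
Qed.

Lemma incr_sorted K (c : 'I_K.+1 -> nat) (e : rel nat) :
  (forall x y : 'I_K.+1, x < y -> e (c x) (c y)) ->
  sorted e (mkseq (fun i => c (inord i)) K.+1).
Proof.
move=> ci; apply/(sortedP 0) => i; rewrite size_mkseq => iK.
rewrite !nth_mkseq //; last exact: ltnW.
by apply: ci; rewrite !inordK // ltnW.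
Qed.

Lemma last_mkseq K (c : 'I_K.+1 -> nat) :
  last 0 (mkseq (fun i => c (inord i)) K.+1) = c ord_max.
Proof.
rewrite -nth_last size_mkseq nth_mkseq //=; congr c.
by apply/val_inj; rewrite /= inordK.
Qed.

Lemma contains_incr (T : filling la) K : T \in ST la ->
  contains T (dsum (incr_perm K.+1) tau) <-> inc_occ (rheight T) (tval T) K.+1.
Proof.
move=> TS; rewrite contains_dsum //; last by move=> x; rewrite !perm1.
split=> [[c [r [ci ri cr rg]]]|[s [sz s1 s2 rg]]].
  exists (mkseq (fun i => c (inord i)) K.+1); split.
  - exact: size_mkseq.
  - exact: incr_sorted.
  - rewrite /mkseq -map_comp.
    apply: (@incr_sorted K (tval T \o c)) => x y xy /=.
    by rewrite !cr !perm1; apply: ri.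
  - by rewrite last_mkseq rheightE // cr perm1.
exists (fun x => nth 0 s x), (fun x => tval T (nth 0 s x)); split.
- exact: sorted_incr.
- move=> x y xy.
  have E (z : 'I_K.+1) : tval T (nth 0 s z) = nth 0 (map (tval T) s) z.
    by rewrite (nth_map 0) ?sz.
  by rewrite !E; apply: (@sorted_incr _ K) => //; rewrite size_map.
- by move=> x; rewrite perm1.
- by rewrite -rheightE //= -[K]/(K.+1.-1) -sz nth_last.
Qed.

Lemma contains_decr (T : filling la) K : T \in ST la ->
  contains T (dsum (decr_perm K.+1) tau) <-> dec_occ (rheight T) (tval T) K.+1.
Proof.
move=> TS; rewrite contains_dsum //; last by move=> x; rewrite !permE rev_ordK.
split=> [[c [r [ci ri cr rg]]]|[s [sz s1 s2 rg]]].
  exists (mkseq (fun i => c (inord i)) K.+1); split.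
  - exact: size_mkseq.
  - exact: incr_sorted.
  - rewrite /mkseq -map_comp.
    apply: (@incr_sorted K (tval T \o c)) => x y xy /=.
    rewrite !cr !permE; apply: ri => /=.
    by have := ltn_ord y; lia.
  - rewrite last_mkseq rheightE // -nth0 nth_mkseq // cr permE.
    rewrite (_ : rev_ord _ = ord_max) //; apply/val_inj.
    by rewrite /= inordK // subn1.
exists (fun x => nth 0 s x), (fun x => tval T (nth 0 s (rev_ord x))); split.
- exact: sorted_incr.
- move=> x y xy; have E (z : 'I_K.+1) :
      tval T (nth 0 s z) = nth 0 (map (tval T) s) z by rewrite (nth_map 0) ?sz.
  rewrite !E; have gt_tr : transitive gtn by move=> ? ? ?; rewrite /gtn /=; lia.
  apply: (sorted_ltn_nth gt_tr 0 s2); rewrite ?inE ?size_map ?sz ?ltn_ord //=.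
  by have := ltn_ord y; lia.
- by move=> x; rewrite permE rev_ordK.
- by rewrite -rheightE //= subnn nth0 -[K in nth _ _ K]/(K.+1.-1) -sz nth_last.
Qed.

(** * Classes with the same 1s outside of the region *)

Definition region_set (T : filling la) : {set 'I_n * 'I_n} :=
  [set p : 'I_n * 'I_n | region T p.1 p.2].

Definition outside (T : filling la) : {ffun 'I_n -> option 'I_n} :=
  [ffun i : 'I_n => if region T i (tval T i) then None else insub (tval T i)].

Definition class_key (T : filling la) := (region_set T, outside T).

Lemma region_setP T1 T2 : region_set T1 = region_set T2 -> region T1 =2 region T2.
Proof.
move=> e x y; have m T (xn : x < n) (yn : y < n) :
    region T x y = ((Ordinal xn, Ordinal yn) \in region_set T) by rewrite in_set.
apply/idP/idP => r; have [xn yn] := region_lt r.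
  by rewrite (m _ xn yn) -e -m.
by rewrite (m _ xn yn) e -m.
Qed.

Lemma rheight_eq T1 T2 : region T1 =2 region T2 -> rheight T1 =1 rheight T2.
Proof. by move=> e x; apply: eq_find => y /=; rewrite e. Qed.

Lemma region_tval T x : region T x (tval T x) -> x < n.
Proof. by case/region_lt. Qed.

Lemma outsideP T1 T2 : T1 \in ST la -> T2 \in ST la -> outside T1 = outside T2 ->
  forall x, region T1 x (tval T1 x) = region T2 x (tval T2 x) /\
    (~~ region T2 x (tval T2 x) -> tval T1 x = tval T2 x).
Proof.
move=> S1 S2 e x; case: (ltnP x n) => xn; last first.
  have out T : region T x (tval T x) = false.
    by apply/negP => /region_tval; rewrite ltnNge xn.
  by rewrite !out !tval_out.
move/ffunP/(_ (Ordinal xn)): e; rewrite !ffunE /=.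
rewrite (@insubT _ (ltn^~ n) _ _ (tval_lt S1 xn)).
rewrite (@insubT _ (ltn^~ n) _ _ (tval_lt S2 xn)).
by case: (region T1 _ _); case: (region T2 _ _) => // -[->].
Qed.

Lemma class_keyP T0 T : T0 \in ST la -> T \in ST la ->
  class_key T = class_key T0 <-> in_class (rheight T0) (tval T0) (tval T).
Proof.
move=> S0 S1; split=> [[/region_setP er eo]|cl].
  have o := outsideP S1 S0 eo; split; first exact: tvalK.
    by move=> x; have [+ _] := o x; rewrite !rheightE // er.
  by move=> x; rewrite rheightE // => nr; apply: (o x).2.
have er := class_region S0 S1 cl; have [_ tS tN] := cl.
congr pair; first by apply/setP => p; rewrite !inE er.
apply/ffunP => i; rewrite !ffunE er -!rheightE // tS.
by case: ifP => // /negbT/tN ->.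
Qed.

Definition core_peaks (T : filling la) : {set 'I_n} :=
  tpeak_set (rheight T) n (tval T) (tval T).

Lemma core_peaks_class T0 T : T0 \in ST la -> T \in ST la ->
  class_key T = class_key T0 ->
  core_peaks T = tpeak_set (rheight T0) n (tval T0) (tval T).
Proof.
move=> S0 S1 [/region_setP er eo]; have o := outsideP S1 S0 eo.
have eh := rheight_eq er; apply/setP => i; rewrite !inE /tpeak /adj /inside.
have eS x : (tval T x < rheight T x) = (tval T0 x < rheight T0 x).
  by have [+ _] := o x; rewrite -!rheightE.
by rewrite !eS !eh.
Qed.

Section Steps.
Variable T : filling la.
Hypothesis TS : T \in ST la.

Let inR x := region T x (tval T x).

Lemma step_in_out x : height x = height x.+1 -> inR x -> ~~ inR x.+1 ->
  tval T x < tval T x.+1.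
Proof.
move=> hx ix ox; case: (boolP (region T x.+1 (tval T x))) => r.
  by rewrite ltnNge; apply: contra ox => le; apply: region_le r.
exact: region_drop r.
Qed.

Lemma step_out_in x : ~~ inR x -> inR x.+1 -> tval T x.+1 < tval T x.
Proof.
move=> ox ix; rewrite ltnNge; apply: contra ox => le.
by apply: region_le ix.
Qed.

Lemma step_in_in x : height x = height x.+1 -> inR x -> inR x.+1 ->
  rheight T x = rheight T x.+1.
Proof.
move=> hx ix ix1; apply/eqP; rewrite eqn_leq andbC (shape_anti (rheight_sym TS)) //=.
rewrite leqNgt; apply/negP => lt; have /(region_drop TS hx) : region T x (rheight T x.+1).
  by rewrite -rheightE.
rewrite -rheightE // ltnn => /(_ isT); rewrite ltnNge ltnW // rheightE //.
Qed.

End Steps.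

(** Steps between a column with 1 inside and one with 1 outside of the region have a
    direction forced by [step_in_out] and [step_out_in]; steps between two columns
    outside are common to the class; a peak inside needs both neighbours inside. *)
Lemma Peak_sub T1 T2 : T1 \in ST la -> T2 \in ST la ->
  class_key T1 = class_key T2 -> core_peaks T1 = core_peaks T2 ->
  Peak T1 \subset Peak T2.
Proof.
move=> S1 S2 ck cp; have [_ eo] := ck; have o := outsideP S1 S2 eo.
have er := region_setP (congr1 fst ck).
apply/subsetP => i; rewrite !PeakE // => /and5P[i0 ni h1 h2 /andP[t1 t2]].
rewrite i0 ni h1 h2 /=; move/eqP: h1 => h1; move/eqP: h2 => h2.
have hi : height i.-1 = height i.-1.+1 by rewrite prednK.
case: (boolP (region T1 i (tval T1 i))) => r1.
  have ri1 : region T1 i.+1 (tval T1 i.+1).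
    by apply: contraLR t2 => /(step_in_out S1 h2 r1) lt; rewrite -leqNgt ltnW.
  have ri0 : region T1 i.-1 (tval T1 i.-1).
    apply: contraLR t1 => nr; rewrite -leqNgt ltnW //.
    by have := step_out_in S1 nr; rewrite prednK //; apply.
  have e1 := step_in_in S1 h2 r1 ri1.
  have e0 : rheight T1 i.-1 = rheight T1 i.
    by have := step_in_in S1 hi ri0; rewrite prednK //; apply.
  have : i \in core_peaks T1.
    rewrite inE /tpeak /adj /inside prednK // i0 t1 t2 !rheightE //.
    by rewrite r1 ri1 ri0 e0 e1 !eqxx ltn_ord ni.
  by rewrite cp inE => /and5P[_ _ _ -> ->].
have nr2 : ~~ region T2 i (tval T2 i) by rewrite -(o i).1.
apply/andP; split.
  case: (boolP (region T2 i.-1 (tval T2 i.-1))) => r0.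
    by have := step_in_out S2 hi r0; rewrite prednK //; apply.
  by rewrite -(o i).2 // -(o i.-1).2.
case: (boolP (region T2 i.+1 (tval T2 i.+1))) => r2; first exact: step_out_in.
by rewrite -(o i).2 // -(o i.+1).2.
Qed.

Definition key T := (class_key T, core_peaks T).

Lemma Peak_key T1 T2 : T1 \in ST la -> T2 \in ST la -> key T1 = key T2 ->
  Peak T1 = Peak T2.
Proof.
move=> S1 S2 [e1 e2 e3]; have ck : class_key T1 = class_key T2 by congr pair.
by apply/eqP; rewrite eqEsubset !Peak_sub.
Qed.

(** The class of [T0] consists of the transversals whose part inside the region is
    arbitrary, which is the situation of [core_card]. *)
Lemma fiber_card K kappa :
  #|[set T in ST_avoid la (dsum (incr_perm K.+1) tau) | key T == kappa]| =
  #|[set T in ST_avoid la (dsum (decr_perm K.+1) tau) | key T == kappa]|.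
Proof.
case: (boolP [exists T0, (T0 \in ST la) && (key T0 == kappa)]); last first.
  rewrite negb_exists => /forallP no.
  have none (s : 'S_(K.+1 + b)) : [set T in ST_avoid la s | key T == kappa] = set0.
    apply/setP => T; rewrite in_set0 in_set; apply/negP => /andP[].
    by rewrite in_set => /andP[TS _] kT; have := no T; rewrite TS kT.
  by rewrite !none.
case/existsP => T0 /andP[S0 /eqP e0].
pose A := [set T in ST la | class_key T == class_key T0].
have AS T : T \in A -> T \in ST la by rewrite inE => /andP[].
have Ack T : T \in A -> class_key T = class_key T0 by rewrite inE => /andP[_ /eqP].
have Acl T : T \in A -> in_class (rheight T0) (tval T0) (tval T).
  by move=> TA; apply/(class_keyP S0 (AS _ TA)); apply: Ack.
have Ainj T1 T2 : T1 \in A -> T2 \in A -> tval T1 =1 tval T2 -> T1 = T2.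
  by move=> A1 A2; apply: tval_inj; apply: AS.
have Asurj t : in_class (rheight T0) (tval T0) t -> exists2 T, T \in A & tval T =1 t.
  case=> tK tS tN; have [||T TS e] := tval_surj tK.
  - move=> i ni; case: (boolP (tval T0 i < rheight T0 i)) => ti; last first.
      by rewrite tN // tval_height.
    by rewrite -tS rheightE // in ti; apply: region_height ti.
  - move=> i ni; rewrite tN ?tval_out // rheightE //.
    by apply/negP => /region_lt[]; rewrite ltnNge ni.
  exists T => //; rewrite inE TS; apply/eqP/class_keyP => //.
  split; [exact: tvalK|by move=> x; rewrite e|by move=> x /tN <-; rewrite e].
have hs := rheight_sym S0.
have core := core_card K hs (rheight_le T0) (tvalK S0) Acl Ainj Asurj kappa.2.
have eh T : T \in A -> rheight T =1 rheight T0.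
  by move=> /Ack[/region_setP/rheight_eq].
have memA T : (T \in ST la) && (key T == kappa) =
    (T \in A) && (tpeak_set (rheight T0) n (tval T0) (tval T) == kappa.2).
  have -> : (T \in A) = (T \in ST la) && (class_key T == class_key T0).
    by rewrite in_set.
  case: (boolP (T \in ST la)) => TS; last by rewrite !andFb.
  rewrite !andTb; apply/eqP/andP => [e|[/eqP ck /eqP cp]].
    have ck : class_key T = class_key T0 := congr1 fst (etrans e (esym e0)).
    split; apply/eqP; first exact: ck.
    by rewrite -e -(core_peaks_class S0 TS ck).
  by rewrite -(core_peaks_class S0 TS ck) in cp; rewrite /key ck cp -e0.
have eI : [set T in ST_avoid la (dsum (incr_perm K.+1) tau) | key T == kappa] =
    [set T in avoid_incr (rheight T0) n K A tval |
      tpeak_set (rheight T0) n (tval T0) (tval T) == kappa.2].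
  apply/setP => T; rewrite [LHS]inE [RHS]inE [X in X && _]inE andbAC memA.
  case: (boolP (T \in A)) => TA /=; last first.
    by rewrite inE (negPf TA).
  rewrite andbC; congr (_ && _).
  apply/idP/(avoid_incrP K hs (rheight_le T0) Acl TA).
    move=> nc occ; case/negP: nc; apply/contains_incr; first exact: AS.
    by case: occ => s [s1 s2 s3 s4]; exists s; split=> //; rewrite eh.
  move=> nocc; apply/negP => /contains_incr; rewrite AS // => /(_ isT) occ.
  apply: nocc; case: occ => s [s1 s2 s3 s4]; exists s; split=> //.
  by rewrite -(eh T TA).
have eJ : [set T in ST_avoid la (dsum (decr_perm K.+1) tau) | key T == kappa] =
    [set T in avoid_decr (rheight T0) n K A tval |
      tpeak_set (rheight T0) n (tval T0) (tval T) == kappa.2].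
  apply/setP => T; rewrite [LHS]inE [RHS]inE [X in X && _]inE andbAC memA.
  case: (boolP (T \in A)) => TA /=; last first.
    by rewrite inE (negPf TA).
  rewrite andbC; congr (_ && _).
  apply/idP/(avoid_decrP K hs (rheight_le T0) Acl TA).
    move=> nc occ; case/negP: nc; apply/contains_decr; first exact: AS.
    by case: occ => s [s1 s2 s3 s4]; exists s; split=> //; rewrite eh.
  move=> nocc; apply/negP => /contains_decr; rewrite AS // => /(_ isT) occ.
  apply: nocc; case: occ => s [s1 s2 s3 s4]; exists s; split=> //.
  by rewrite -(eh T TA).
by rewrite eI eJ core.
Qed.

Lemma Peak_gf_key (A : {set filling la}) : A \subset ST la ->
  Peak_gf A = (\sum_kappa (if [pick T in ST la | key T == kappa] is Some T
    then tmonomial (Peak T) *+ #|[set T in A | key T == kappa]| else 0))%R.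
Proof.
move=> /subsetP AS; rewrite /Peak_gf (partition_big key xpredT) //=.
apply: eq_bigr => kappa _; case: pickP => [T0 /andP[S0 /eqP k0]|none].
  rewrite -GRing.sumr_const; apply: eq_big => [T|T /andP[TA /eqP kT]].
    by rewrite in_set.
  by rewrite (Peak_key _ S0) ?AS // kT.
apply: big_pred0 => T; apply/negP => /andP[/AS TS kT].
by have := none T; rewrite TS kT.
Qed.

End Region.
End Diagram.

Theorem theorem1p6 (k : nat) (hk : 1 <= k)
    (la : seq nat) (hla : is_partition la) (hsc : self_conjugate la)
    (b : nat) (tau : 'S_b) :
  Peak_gf (ST_avoid la (dsum (incr_perm k) tau))
  = Peak_gf (ST_avoid la (dsum (decr_perm k) tau)).
Proof.
case: k hk => [|K] hk; first by [].
have sub (s : 'S_(K.+1 + b)) : ST_avoid la s \subset ST la.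
  by apply/subsetP => T; rewrite inE => /andP[].
rewrite (Peak_gf_key hla hsc tau (sub (dsum (incr_perm K.+1) tau))).
rewrite (Peak_gf_key hla hsc tau (sub (dsum (decr_perm K.+1) tau))).
by apply: eq_bigr => kappa _; rewrite fiber_card.
Qed.
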